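(* There is a positive constant $C_1$ such that the following holds. Let $m,n$ be integers satisfying $C_1\le n$ and $2n\le m$, let $r>m$ be an integer, and let $\delta=n/m$. Then: 1. If $r\ge n2^{n-1}$ then $\chi^n(m,r)\ge n(\ln(n))^2\,\dfrac{\delta}{C_1(\ln(1/\delta))^2}$. 2. If $r\ge C_1 m$ then $\chi^n(m,r)\ge n(\ln(n))^2\,\dfrac{\delta^2}{C_1(\ln(1/\delta))^2}$.
   Context: Interval notation denotes sets of integers. For a finite set $Y$ of integers (''keys''), a storage function for $Y$ is a strictly order preserving map $f:Y\to[1,m]$ ($x<y$ implies $f(x)<f(y)$); $[1,m]$ is the set of cells of an array of size $m$. The online labeling (array loading) game $G^n(m,r)$, for integers $n\le m<r$, is played by an adversary and a (deterministic) algorithm in $n$ steps. At step $t\in[1,n]$ the adversary selects a key $y^t\in\{1,\dots,r\}\setminus\{y^1,\dots,y^{t-1}\}$, and the algorithm, before seeing later keys, responds with a storage function $f^t$ for the set $Y^t=\{y^1,\dots,y^t\}$. A key $y\in Y^t$ is relocated at step $t$ if $y=y^t$ or $f^t(y)\ne f^{t-1}(y)$; $Rel^t$ is the set of keys relocated at step $t$. The total cost is $\chi^n=\sum_{t=1}^n|Rel^t|$. The algorithm wants to minimize and the adversary to maximize this cost. $\chi^n(m,r)$ denotes the smallest cost that can be achieved by the algorithm against the best adversary, i.e. the minimum over algorithms of the maximum over adversary key sequences of the total cost. *)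

(* Defs.v *)
From HB Require Import structures.
From mathcomp Require Import all_boot.

Set Implicit Arguments.
Unset Strict Implicit.
Unset Printing Implicit Defensive.

(* Keys {1..r} and cells [1,m] are the ordinals 'I_r and 'I_m, so the ordinal
   of value i stands for the integer i + 1.  All quantities are invariant
   under this shift. *)

Section Game.
Variables n m r : nat.

(* A storage function for Y is represented by any total function that extends
   it; the values outside Y are junk and are never inspected. *)
Definition storage_fun (Y : {set 'I_r}) (f : {ffun 'I_r -> 'I_m}) : bool :=
  [forall x in Y, forall y in Y, (x < y) ==> (f x < f y)].

(* A deterministic algorithm maps the keys y^1, ..., y^t revealed so far (in
   order of arrival, t <= n) to its current storage function f^t. *)
Definition algorithm := {ffun n.-bseq 'I_r -> {ffun 'I_r -> 'I_m}}.

Definition legal (A : algorithm) : bool :=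
  [forall h : n.-bseq 'I_r, uniq h ==> storage_fun [set x in h] (A h)].

Definition history (s : n.-tuple 'I_r) (t : nat) : n.-bseq 'I_r :=
  [bseq of take t (bseq_of_tuple s)].

(* t : 'I_n indexes step t + 1.  At that step the new key is tnth s t, the set
   of stored keys consists of the first t + 1 entries of s, and every stored
   key other than the new one is already in the domain of the previous storage
   function. *)
Definition relocated (A : algorithm) (s : n.-tuple 'I_r) (t : 'I_n) :
    {set 'I_r} :=
  [set y in history s t.+1 |
     (y == tnth s t) || (A (history s t.+1) y != A (history s t) y)].

Definition cost (A : algorithm) (s : n.-tuple 'I_r) : nat :=
  \sum_(t < n) #|relocated A s t|.

(* As the algorithm is deterministic, an adversary is a sequence of n distinct
   keys. *)
Definition worst_cost (A : algorithm) : nat :=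
  \max_(s : n.-tuple 'I_r | uniq s) cost A s.

(* The default value n * n bounds every cost, so it does not affect the
   minimum; see chi_attained and chi_le. *)
Definition chi : nat := \big[minn/n * n]_(A : algorithm | legal A) worst_cost A.

Lemma worst_cost_le A : worst_cost A <= n * n.
Proof.
apply/bigmax_leqP => s _.
rewrite /cost -[X in _ <= X * _](card_ord n) -sum_nat_const.
apply: leq_sum => t _.
apply: leq_trans (size_bseq (history s t.+1)).
apply: leq_trans (card_size _).
by apply: subset_leq_card; apply/subsetP => y; rewrite inE => /andP[].
Qed.

Lemma legal_exists : 0 < n -> n <= m -> exists A, legal A.
Proof.
move=> n_gt0 le_nm; have m_gt0 := leq_trans n_gt0 le_nm.
exists [ffun h : n.-bseq 'I_r => [ffun y : 'I_r =>
  insubd (Ordinal m_gt0) (count (fun z : 'I_r => z < y) h)]].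
apply/forallP => h; apply/implyP => _.
have rank_lt (y : 'I_r) : y \in h -> count (fun z : 'I_r => z < y) h < m.
  move=> hy; apply: leq_trans le_nm; apply: leq_trans (size_bseq h).
  rewrite -(count_predC (fun z : 'I_r => z < y)) -addn1 leq_add2l -has_count.
  by apply/hasP; exists y => //=; rewrite ltnn.
apply/forallP => x; apply/implyP; rewrite inE => hx.
apply/forallP => y; apply/implyP; rewrite inE => hy.
apply/implyP => lt_xy; rewrite !ffunE !val_insubd !rank_lt //.
have -> : count (fun z : 'I_r => z < y) h =
    count (fun z : 'I_r => z < x) h + count (fun z : 'I_r => x <= z < y) h.
  elim: (h : seq _) => //= z l ->; rewrite addnACA; congr (_ + _).
  by case: (ltnP z x) => //= lt_zx; rewrite (ltn_trans lt_zx lt_xy).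
rewrite -addn1 leq_add2l -has_count.
by apply/hasP; exists x => //=; rewrite leqnn.
Qed.

Lemma chi_le A : legal A -> chi <= worst_cost A.
Proof.
move=> lA; rewrite /chi; have := mem_index_enum A.
elim: (index_enum _) => // B l IHl; rewrite inE big_cons.
case/predU1P => [<-|/IHl le_l]; first by rewrite lA geq_minl.
by case: ifP => // _; rewrite geq_min le_l orbT.
Qed.

Lemma chi_attained :
  0 < n -> n <= m -> exists2 A, legal A & worst_cost A = chi.
Proof.
move=> n_gt0 le_nm; have [A0 lA0] := legal_exists n_gt0 le_nm.
have [A lA minA] := arg_minnP worst_cost lA0.
exists A => //; apply/eqP; rewrite eqn_leq chi_le // andbT /chi.
elim/big_ind: _ => [|x y lex ley|B lB]; first exact: worst_cost_le.
  by rewrite leq_min lex.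
exact: minA.
Qed.

End Game.

(* Main.v *)
(* The algorithm may be assumed lazy: when y arrives, only a block of
   consecutive keys around y moves, and the number of keys moved in this way is
   at most the true cost.  The adversary keeps a chain of d nested intervals of
   stored keys.  The mass of an interval is lam * (number of keys of the
   universe in it) + (number of stored keys in it), its density D is mass
   divided by the number of cells it spans; lam = 0 in the first part, while in
   the second part lam is chosen so that a density above 2 forces an unused key
   inside.  Every interval X maximises mass * D ^ N over the subintervals of
   the denser half of the core of its parent; so no prefix or suffix of X
   carrying at least 1/16 of its mass is denser than b * D(X), where
   b = exp (1/d) and N = 4d, and therefore the core, between the margins, keeps
   the density up to a factor b.  Hence the density decreases along the chain
   by at most a factor e altogether, while an interval that has received more
   than a 1/theta fraction of its mass is denser than its parent by a factor
   1 + 1/(3 theta).  As the density is bounded, at any time at most half of the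
   intervals are old in this sense.  An interval is abandoned only when half of
   one of its margins has been relocated, which costs a constant fraction of
   its mass, and margins of different levels are disjoint.  Each step thus adds
   d/2 units of age, each paid by about theta / Q relocations. *)
Require Import Defs.
From mathcomp Require Import all_boot all_order all_algebra.
From mathcomp Require Import reals sequences exp.
From mathcomp Require Import zify ring lra.

Set Implicit Arguments.
Unset Strict Implicit.
Unset Printing Implicit Defensive.
Import Order.TTheory GRing.Theory Num.Theory.

(** * Lazy relocations *)

(* [lia] splits on every boolean atom in the context, so all hypotheses that
   are not order relations on [nat] are cleared first. *)
Ltac order_lia :=
  repeat match goal with
  | H : ?P |- _ =>
    lazymatch P with
    | is_true (leq _ _) => fail
    | is_true (andb (leq _ _) (leq _ _)) => fail
    | is_true (~~ leq _ _) => fail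
    | leq _ _ = _ => fail
    | (_ : nat) = _ => fail
    | (_ : nat) <> _ => fail
    | _ => clear H
    end
  end; lia.

Section LazyGame.
Variables (m r : nat).
Implicit Types (Y J : {set 'I_r}) (g : 'I_r -> nat).

Definition increasing_on Y g :=
  forall x z, x \in Y -> z \in Y -> x < z -> g x < g z.

Definition placed Y g := increasing_on Y g /\ (forall x, x \in Y -> g x < m).

(* [J] is the set of keys that a lazy algorithm relocates when it inserts [y]:
   a block of consecutive stored keys around [y]. *)
Definition lazy_move Y (y : 'I_r) g g' J :=
  [/\ placed (y |: Y) g', y \in J, J \subset y |: Y,
      (forall a b c, a \in J -> b \in y |: Y -> c \in J -> a <= b <= c -> b \in J)
    & (forall x, x \in Y -> x \notin J -> g' x = g x)].

(* The keys at which the lazy positions [g] differ from the true ones [f] pay for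
   the relocated block. *)
Lemma lazy_follow Y y g f :
  y \notin Y -> placed Y g -> placed (y |: Y) f ->
  exists g' J, lazy_move Y y g g' J /\
    #|[set z in y |: Y | g' z != f z]| + #|J|
      <= #|[set z in Y | g z != f z]|.+1.
Proof.
move=> yNY [gm gb] [fm fb]; set Y' := y |: Y.
(* A key [z] right of [y] moves only if every stored [v] in [(y, z]] is overrun: some key from [y]
   on and before [v] has its true position at or beyond the lazy position of [v]. The block thus
   ends just before the first key that is not overrun; [L] is the mirror image. *)
pose R (z : 'I_r) := [forall v in Y, (y < v <= z) ==>
   [exists u in Y', (y <= u < v) && (g v <= f u)]].
pose L (z : 'I_r) := [forall v in Y, (z <= v < y) ==>
   [exists u in Y', (v < u <= y) && (f u <= g v)]].
pose J := [set z in Y' | if y <= z then R z else L z].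
pose g' z := if z \in J then f z else g z.
have yY' : y \in Y' by rewrite setU11.
have JE z : (z \in J) = (z \in Y') && (if y <= z then R z else L z) by rewrite inE.
have Ry : R y by apply/forall_inP => v vY; apply/implyP; lia.
have yJ : y \in J by rewrite JE yY' leqnn.
have RP z v : R z -> v \in Y -> y < v <= z ->
    exists2 u, u \in Y' & (y <= u < v) && (g v <= f u).
  by move=> /forall_inP /(_ v) H vY hv; move: (H vY); rewrite hv /= => /exists_inP[u]; exists u.
have LP z v : L z -> v \in Y -> z <= v < y ->
    exists2 u, u \in Y' & (v < u <= y) && (f u <= g v).
  by move=> /forall_inP /(_ v) H vY hv; move: (H vY); rewrite hv /= => /exists_inP[u]; exists u.
have RN z : ~~ R z -> exists2 v, v \in Y & (y < v <= z) /\
    (forall u, u \in Y' -> y <= u < v -> f u < g v).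
  rewrite negb_forall_in => /exists_inP[v vY]; rewrite negb_imply => /andP[h1 /exists_inPn h2].
  exists v => //; split=> // u uY hu; move: (h2 u uY); rewrite hu /=; lia.
have LN z : ~~ L z -> exists2 v, v \in Y & (z <= v < y) /\
    (forall u, u \in Y' -> v < u <= y -> g v < f u).
  rewrite negb_forall_in => /exists_inP[v vY]; rewrite negb_imply => /andP[h1 /exists_inPn h2].
  exists v => //; split=> // u uY hu; move: (h2 u uY); rewrite hu /=; lia.
have Rle (a b : 'I_r) : a <= b -> R b -> R a.
  move=> ab /forall_inP H; apply/forall_inP => v vY; apply/implyP => hv.
  by have := H v vY; have -> : y < v <= b by lia.
have Lle (a b : 'I_r) : a <= b -> L a -> L b.
  move=> ab /forall_inP H; apply/forall_inP => v vY; apply/implyP => hv.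
  by have := H v vY; have -> : a <= v < y by lia.
have JY' : J \subset Y' by apply/subsetP => z; rewrite JE => /andP[].
have g'J z : z \in J -> g' z = f z by rewrite /g' => ->.
have g'N z : z \notin J -> g' z = g z by rewrite /g' => /negPf ->.
clearbody g' J R L.
have Y'Y z : z \in Y' -> z != y -> z \in Y by rewrite !inE => /orP[->|].
have gle a b : a \in Y -> b \in Y -> a <= b -> g a <= g b.
  move=> aY bY; rewrite leq_eqVlt => /orP[/eqP/val_inj -> //|ab]; exact/ltnW/gm.
have fle a b : a \in Y' -> b \in Y' -> a <= b -> f a <= f b.
  move=> aY bY; rewrite leq_eqVlt => /orP[/eqP/val_inj -> //|ab]; exact/ltnW/fm.
have JN z : z \in Y' -> z \notin J -> z \in Y.
  by move=> zY zJ; apply: Y'Y => //; apply: contraNneq zJ => ->.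
exists g', J; split; last first.
  (* Taking [v = z] in [R z] gives [g z <= f u < f z], so every relocated old key disagreed before
     and agrees afterwards. Only [y] moves without such a payment. *)
  suff : [set z in Y' | g' z != f z] :|: (J :\ y) \subset [set z in Y | g z != f z].
    move/subset_leq_card; rewrite cardsU [X in _ - X](_ : _ = 0); last first.
      apply/eqP; rewrite cards_eq0; apply/eqP/setP => z; rewrite !inE.
      by case: (boolP (z \in J)) => [/g'J ->|_]; rewrite ?eqxx ?andbF.
    by rewrite (cardsD1 y J) yJ; order_lia.
  apply/subsetP => z; rewrite in_setU => /orP[].
    rewrite inE => /andP[zY]; have [/g'J ->|zJ] := boolP (z \in J); first by rewrite eqxx.
    by rewrite g'N // => h; rewrite inE h andbT; apply: JN.
  rewrite in_setD1 => /andP[zy zJ]; move: zJ; rewrite JE => /andP[zY' h].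
  have zY := Y'Y z zY' zy; rewrite inE zY /=.
  have zy' : (z : nat) <> y by move=> e; move/eqP: zy; apply; apply: val_inj.
  move: h; case: leqP => yz h.
    have [|u uY /andP[hu1 hu2]] := RP z z h zY; first order_lia.
    have := fm u z uY zY'; order_lia.
  have [|u uY /andP[hu1 hu2]] := LP z z h zY; first order_lia.
  have := fm z u zY' uY; order_lia.
split=> //.
- split=> [u v uY' vY' uv|x xY']; last first.
    by have [/g'J ->|xJ] := boolP (x \in J); [apply: fb | rewrite g'N //; apply: gb; apply: JN].
  have [uJ|uJ] := boolP (u \in J); have [vJ|vJ] := boolP (v \in J);
    rewrite ?(g'J _ uJ) ?(g'J _ vJ) ?(g'N _ uJ) ?(g'N _ vJ).
  + exact: fm.
  + have vY := JN v vY' vJ.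
    have yv : y < v.
      rewrite ltnNge; apply: contra vJ => vy; rewrite JE vY' /=.
      move: uJ; rewrite JE uY'; case: ifP => h1 h2; first order_lia.
      case: ifP => h3; last by apply: Lle h2; order_lia.
      by have -> : v = y by apply: ord_inj; order_lia.
    have : ~~ R v by move: vJ; rewrite JE vY' (ltnW yv).
    (* The obstacle [v0] separates the two: true positions from [y] up to [v0] stay below [g v0],
       and [g v0 <= g v]. *)
    case/RN => v0 v0Y [hv0 H]; have [yu|uy] := leqP y u; last first.
      have := H y yY'; have := fm u y uY' yY' uy; have := gle v0 v v0Y vY; order_lia.
    have hu : u < v0.
      rewrite ltnNge; apply/negP => v0u.
      move: uJ; rewrite JE uY' yu /= => Ru.
      have [|w wY /andP[hw1 hw2]] := RP u v0 Ru v0Y; first order_lia.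
      by have := H w wY hw1; order_lia.
    have := H u uY'; have := gle v0 v v0Y vY; order_lia.
  + have uY := JN u uY' uJ.
    have uy : u < y.
      rewrite ltnNge; apply: contra uJ => yu; rewrite JE uY' yu /=.
      move: vJ; rewrite JE vY'; case: ifP => h1 h2; last order_lia.
      by apply: Rle h2; order_lia.
    have : ~~ L u by move: uJ; rewrite JE uY' leqNgt uy.
    case/LN => v0 v0Y [hv0 H]; have [yv|vy] := leqP y v.
      have := H y yY'; have := fle y v yY' vY' yv; have := gle u v0 uY v0Y; order_lia.
    have hv : v0 < v.
      rewrite ltnNge; apply/negP => vv0.
      move: vJ; rewrite JE vY' leqNgt vy /= => Lv.
      have [|w wY /andP[hw1 hw2]] := LP v v0 Lv v0Y; first order_lia.
      by have := H w wY hw1; order_lia.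
    have := H v vY'; have := gle u v0 uY v0Y; order_lia.
  + by apply: gm => //; apply: JN.
- move=> a b c; rewrite !JE => /andP[aY hA] bY /andP[cY hC] abc; rewrite bY /=.
  case: ifP => h; first by move: hC; case: ifP => h' hC; [apply: Rle hC; order_lia | order_lia].
  by move: hA; case: ifP => h' hA; [order_lia | apply: Lle hA; order_lia].
- by move=> x xY xJ; apply: g'N.
Qed.

End LazyGame.

(** Transfers a strategy against lazy relocations, given by an invariant whose last argument is the
    lazy cost, to the actual game. The number of keys on which lazy and true positions disagree
    serves as a debt that the true cost has already covered. *)
Lemma lazy_adversary n m r (A : algorithm n m r) g0
    (Inv : nat -> {set 'I_r} -> ('I_r -> nat) -> nat -> Prop) :
  legal A -> Inv 0 set0 g0 0 ->
  (forall t Y g c, t < n -> Inv t Y g c -> placed m Y g ->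
     exists2 y, y \notin Y & forall g' J, lazy_move m Y y g g' J ->
       Inv t.+1 (y |: Y) g' (c + #|J|)) ->
  exists2 s : n.-tuple 'I_r, uniq s &
    exists Y g c, [/\ Inv n Y g c, placed m Y g, #|Y| = n & c <= cost A s].
Proof.
move=> lA I0 step.
pose F (h : seq 'I_r) (x : 'I_r) : nat := A (insub_bseq n h) x.
have FE (h : n.-bseq 'I_r) (h' : seq 'I_r) : h' = h -> forall x, F h' x = A h x :> nat.
  by move=> -> x; rewrite /F /insub_bseq valKd.
have Fm (h : seq 'I_r) : uniq h -> size h <= n -> placed m [set x in h] (F h).
  move=> uh sh; split=> [x z xh zh xz|x _]; last exact: ltn_ord.
  pose hb := Bseq sh; rewrite !(FE hb) //.
  move/forallP: lA => /(_ hb); rewrite uh /= => /forall_inP/(_ x xh).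
  by move/forall_inP => /(_ z zh); rewrite xz.
(* The relocated keys restated for plain sequences, so that a history can grow key by key. *)
pose rel (h : seq 'I_r) i : {set 'I_r} := [set z : 'I_r in take i.+1 h | (z \notin take i h) ||
                   (F (take i.+1 h) z != F (take i h) z)].
pose pc t (h : seq 'I_r) := \sum_(i < t) #|rel h i|.
suff [h [uh sh [Y [g [c [IY pY cY hc]]]]]] : exists h, [/\ uniq h, size h = n &
    exists Y g c, [/\ Inv n Y g c, placed m Y g, #|Y| = n & c <= pc n h]].
  have sh' : size h == n by apply/eqP.
  exists (Tuple sh') => //; exists Y, g, c; split=> //; apply: leq_trans hc _.
  apply: leq_sum => t _; apply/subset_leq_card/subsetP => z.
  rewrite !inE => /andP[zt hz]; apply/andP; split=> //.
  case/orP: hz => hz; apply/orP; [left|right].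
    move: zt; rewrite (take_nth z) ?sh // mem_rcons inE (negPf hz) orbF.
    by rewrite (tnth_nth z) /=.
  apply: contra hz => /eqP hz; apply/eqP.
  by rewrite !(FE (history (Tuple sh') _) _ (erefl _)) hz.
suff H t : t <= n -> exists h, [/\ uniq h, size h = t &
    exists Y g c, [/\ Y = [set x in h], Inv t Y g c, placed m Y g &
      c + #|[set z in Y | g z != F h z]| <= pc t h]].
  have [h [uh sh [Y [g [c [Yh IY pY hc]]]]]] := H n (leqnn n).
  exists h; split=> //; exists Y, g, c; split=> //; last exact: leq_trans (leq_addr _ _) hc.
  by rewrite Yh cardsE (card_uniqP uh).
elim: t => [|t IH] tn.
  exists [::]; split=> //; exists set0, g0, 0; split=> //.
  - by split=> x; rewrite inE.
  - rewrite add0n /pc big_ord0 leqn0 cards_eq0; apply/eqP/setP => x.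
    by rewrite !inE.
have [h [uh sh [Y [g [c [Yh IY pY hc]]]]]] := IH (ltnW tn).
have [y yY hy] := step t Y g c tn IY pY.
have yh : y \notin h by move: yY; rewrite Yh inE.
have Y'E : y |: Y = [set x in rcons h y].
  by apply/setP => x; rewrite Yh !inE mem_rcons inE.
have u' : uniq (rcons h y) by rewrite rcons_uniq yh.
have s' : size (rcons h y) = t.+1 by rewrite size_rcons sh.
have pY' : placed m (y |: Y) (F (rcons h y)) by rewrite Y'E; apply: Fm; rewrite ?s'.
have [g' [J [lJ hJ]]] := lazy_follow yY pY pY'.
exists (rcons h y); split=> //; exists (y |: Y), g', (c + #|J|); split=> //.
- exact: hy.
- by case: lJ.
have E1 : pc t.+1 (rcons h y) = pc t h + #|rel (rcons h y) t|.
  rewrite /pc big_ord_recr /=; congr (_ + _); apply: eq_bigr => i _.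
  by rewrite /rel -cats1 !takel_cat ?sh // ltnW.
have tk : take t (rcons h y) = h by rewrite -sh -cats1 take_size_cat.
have tk' : take t.+1 (rcons h y) = rcons h y by rewrite -s' take_size.
rewrite E1.
(* An old key that disagrees with the new true positions either disagreed before or has just been
   moved by the algorithm, which pays for it. *)
have sub : [set z in Y | g z != F (rcons h y) z] \subset
    [set z in Y | g z != F h z] :|: (rel (rcons h y) t :\ y).
  apply/subsetP => z; rewrite !inE tk tk' => /andP[zY hz]; rewrite zY /=.
  have zh : z \in h by move: zY; rewrite Yh inE.
  have zy : z != y by apply: contraNneq yY => <-.
  rewrite mem_rcons inE zh zy orbT /=; apply/norP => -[/negPn/eqP e1 /negPn/eqP e2].
  by move: hz; rewrite e1 e2 eqxx.
have yr : y \in rel (rcons h y) t by rewrite inE tk tk' mem_rcons inE eqxx yh.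
have := subset_leq_card sub; rewrite cardsU.
have := cardsD1 y (rel (rcons h y) t); rewrite yr.
move: hJ hc; lia.
Qed.

Local Open Scope ring_scope.

(** * Mass and density of key intervals *)

Section Mass.
Variables (R : realType) (m r : nat) (lam Q : R).
Implicit Types (Y J : {set 'I_r}) (g : 'I_r -> nat) (x y z : 'I_r).

(** Half-open, so that counts and masses add up over adjacent intervals. *)
Definition keys Y x z := #|[set y in Y | (x < y <= z)%N]|.

Definition mass Y x z : R := lam * ((z : nat)%:R - (x : nat)%:R) + (keys Y x z)%:R.

Definition len g x z : R := (g z)%:R - (g x)%:R.

(** [Q] bounds the mass between consecutive stored keys, the [1] being the right end; it is the
    granularity of mass. *)
Definition short_gaps Y := forall x z, x \in Y -> z \in Y -> (x < z)%N ->
  (forall y, y \in Y -> ~~ (x < y < z)%N) ->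
  lam * ((z : nat)%:R - (x : nat)%:R) + 1 <= Q.

Lemma keysD Y x y z : (x <= y <= z)%N -> keys Y x z = (keys Y x y + keys Y y z)%N.
Proof.
move=> /andP[xy yz]; rewrite /keys -cardsUI [X in (_ + X)%N](_ : _ = 0%N) ?addn0.
  congr #|pred_of_set _|; apply/setP => v; rewrite !inE; case: (v \in Y) => //=; lia.
apply/eqP; rewrite cards_eq0; apply/eqP/setP => v; rewrite !inE; case: (v \in Y) => //=; lia.
Qed.

Lemma massD Y x y z : (x <= y <= z)%N -> mass Y x z = mass Y x y + mass Y y z.
Proof. by move=> h; rewrite /mass (keysD Y h) natrD; ring. Qed.

Lemma lenD g x y z : len g x z = len g x y + len g y z.
Proof. by rewrite /len; ring. Qed.

Lemma keysxx Y x : keys Y x x = 0%N.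
Proof.
by apply/eqP; rewrite cards_eq0; apply/eqP/setP => v; rewrite !inE; case: (v \in Y) => //=; lia.
Qed.

Lemma massxx Y x : mass Y x x = 0.
Proof. by rewrite /mass subrr mulr0 add0r keysxx. Qed.

Lemma keys_insert Y x z y : y \notin Y ->
  keys (y |: Y) x z = ((x < y <= z)%N + keys Y x z)%N.
Proof.
move=> yY; rewrite /keys; case: (boolP (x < y <= z)%N) => h /=.
  rewrite (_ : [set v in y |: Y | _] = y |: [set v in Y | (x < v <= z)%N]).
    by rewrite cardsU1 inE (negPf yY).
  by apply/setP => v; rewrite !inE andb_orl; case: eqVneq => [->|] //=; rewrite h.
rewrite add0n; congr #|pred_of_set _|; apply/setP => v; rewrite !inE andb_orl.
by case: eqVneq => [->|] //=; rewrite (negPf h) andbF.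
Qed.

Lemma mass_insert Y x z y : y \notin Y ->
  mass (y |: Y) x z = mass Y x z + (x < y <= z)%N%:R.
Proof. by move=> yY; rewrite /mass keys_insert // natrD; ring. Qed.

Lemma succ_key Y x z : z \in Y -> (x < z)%N ->
  exists x', [/\ x' \in Y, (x < x' <= z)%N & forall y, y \in Y -> ~~ (x < y < x')%N].
Proof.
move=> zY xz; pose P v := (v \in Y) && (x < v)%N.
have Pz : P z by rewrite /P zY.
case: (@arg_minnP _ z P (fun v : 'I_r => v : nat) Pz) => x' /andP[xY xx'] H.
exists x'; split=> //; first by rewrite xx' H.
move=> y yY; apply/negP => /andP[h1 h2]; have := H y; rewrite /P yY h1 => /(_ isT); lia.
Qed.

Lemma keys_succ Y x z : z \in Y -> (x < z)%N ->
  (forall y, y \in Y -> ~~ (x < y < z)%N) -> keys Y x z = 1%N.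
Proof.
move=> zY xz H; rewrite /keys -(cards1 z); congr #|pred_of_set _|.
apply/setP => v; rewrite !inE; case: (eqVneq v z) => [->|vz].
  by rewrite zY xz leqnn.
apply/negP => /and3P[vY xv vz']; have := H v vY; rewrite xv /= -leqNgt => zv.
by move/eqP: vz; apply; apply: ord_inj; lia.
Qed.

Lemma mass_succ Y x z : short_gaps Y -> x \in Y -> z \in Y -> (x < z)%N ->
  (forall y, y \in Y -> ~~ (x < y < z)%N) -> mass Y x z <= Q.
Proof. by move=> sg xY zY xz H; rewrite /mass keys_succ //; apply: sg. Qed.

Hypotheses (lam_ge0 : 0 <= lam) (Q_ge0 : 0 <= Q).

Lemma mass_ge0 Y x z : (x <= z)%N -> 0 <= mass Y x z.
Proof.
by move=> xz; rewrite /mass addr_ge0 // mulr_ge0 // subr_ge0 ler_nat.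
Qed.

Lemma keys_le_mass Y x z : (x <= z)%N -> (keys Y x z)%:R <= mass Y x z.
Proof. by move=> xz; rewrite /mass lerDr mulr_ge0 // subr_ge0 ler_nat. Qed.

Lemma mass_ge1 Y x z : z \in Y -> (x < z)%N -> 1 <= mass Y x z.
Proof.
move=> zY xz; apply: le_trans (keys_le_mass _ (ltnW xz)).
by rewrite ler1n /keys card_gt0; apply/set0Pn; exists z; rewrite inE zY xz leqnn.
Qed.

Lemma mass_le_keys Y x z : short_gaps Y -> x \in Y -> z \in Y -> (x <= z)%N ->
  mass Y x z <= Q * (keys Y x z)%:R.
Proof.
move=> sg; have [k] := ubnP (z - x); elim: k x => // k IH x hk xY zY.
rewrite leq_eqVlt => /orP[/eqP/ord_inj ->|xz].
  by rewrite massxx keysxx mulr0.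
have [x' [x'Y hx' nb]] := succ_key zY xz.
have hx : (x <= x' <= z)%N by lia.
rewrite (massD Y hx) (keysD Y hx) natrD mulrDr lerD //.
  have xx' : (x < x')%N by case/andP: hx'.
  by rewrite keys_succ // mulr1; apply: mass_succ.
by apply: IH => //; lia.
Qed.

(** The last stored key whose mass from [x] does not exceed [tau] works: its successor overshoots,
    and one gap has mass at most [Q]. *)
Lemma mass_split Y x z tau : short_gaps Y -> x \in Y -> z \in Y -> (x <= z)%N ->
  0 <= tau <= mass Y x z ->
  exists y, [/\ y \in Y, (x <= y <= z)%N & tau - Q <= mass Y x y <= tau].
Proof.
move=> sg xY zY xz /andP[t0 tz].
pose P v := [&& v \in Y, (x <= v <= z)%N & mass Y x v <= tau].
have Px : P x.
  by rewrite /P xY leqnn xz /=; rewrite massxx.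
case: (@arg_maxnP _ x P (fun v : 'I_r => v : nat) Px) => y /and3P[yY /andP[xy yz] yt] H.
exists y; split; rewrite ?xy ?yz ?yt //= andbT.
move: yz; rewrite leq_eqVlt => /orP[/eqP/ord_inj e|yz].
  by rewrite e; move: tz Q_ge0; lra.
have [y' [y'Y /andP[hy1 hy2] nb]] := succ_key zY yz.
have : ~~ P y' by apply/negP => /H; move: hy1; clear; lia.
rewrite /P y'Y hy2 andbT (leq_trans xy (ltnW hy1)) /= -ltNge (massD Y (y := y)) ?xy ?(ltnW hy1) //.
have := mass_succ sg yY y'Y hy1 nb; lra.
Qed.

Lemma len_gt0 Y g x z : placed m Y g -> x \in Y -> z \in Y -> (x < z)%N -> 0 < len g x z.
Proof. by move=> [gm _] xY zY xz; rewrite /len subr_gt0 ltr_nat gm. Qed.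

(** Stored keys occupy distinct cells. With [mass_le_keys] this bounds every density by [Q]. *)
Lemma keys_le_len Y g x z : placed m Y g -> x \in Y -> z \in Y -> (x <= z)%N ->
  (keys Y x z)%:R <= len g x z.
Proof.
move=> [gm gb] xY zY; have [k] := ubnP (z - x); elim: k x xY => // k IH x xY hk.
rewrite leq_eqVlt => /orP[/eqP/ord_inj ->|xz].
  by rewrite /len subrr keysxx.
have [x' [x'Y hx' nb]] := succ_key zY xz.
have hx : (x <= x' <= z)%N by lia.
have {}IH := IH x' x'Y; rewrite (keysD Y hx) natrD (lenD g x x' z) lerD //.
  rewrite keys_succ //; last by case/andP: hx'.
  by rewrite /len lerBrDr -natrD ler_nat add1n; apply: gm => //; case/andP: hx'.
by apply: IH; lia.
Qed.

End Mass.

(** * Margins and relocated blocks *)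

Section LazyMoves.
Variables (R : realType) (m r : nat) (lam Q : R).
Implicit Types (x l z : 'I_r) (J : {set 'I_r}).
Variables (Y : {set 'I_r}) (y : 'I_r) (g g' : 'I_r -> nat) (J : {set 'I_r}).
Hypotheses (lam_ge0 : 0 <= lam) (Q_gt0 : 0 < Q).
Hypotheses (sgY : short_gaps lam Q Y) (yNY : y \notin Y) (mv : lazy_move m Y y g g' J).
Local Notation mass := (@mass R r lam Y).

(** Each margin drops its outer end, so the two margins and the open core are disjoint and fit into
    the open core of the parent. *)
Definition block_l x l := [set v in J | (x < v <= l)%N].
Definition block_r x l := [set v in J | (x <= v < l)%N].
Definition block x l := [set v in J | (x < v < l)%N].

Lemma block_split (p x l t z q : 'I_r) :
  (p <= x)%N -> (x < l)%N -> (l < t)%N -> (t < z)%N -> (z <= q)%N ->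
  (#|block_l x l| + #|block_r t z| + #|block l t| <= #|block p q|)%N.
Proof.
move=> px xl lt tz zq.
rewrite -(cardsUI (block_l x l)) (_ : #|block_l x l :&: _| = 0%N) ?addn0; last first.
  by apply/eqP; rewrite cards_eq0; apply/eqP/setP => v; rewrite !inE;
    case: (v \in J) => //=; order_lia.
rewrite -(cardsUI (_ :|: _)) (_ : #|_ :&: block l t| = 0%N) ?addn0; last first.
  by apply/eqP; rewrite cards_eq0; apply/eqP/setP => v; rewrite !inE;
    case: (v \in J) => //=; order_lia.
by apply/subset_leq_card/subsetP => v; rewrite !inE; case: (v \in J) => //=; order_lia.
Qed.

Let yJ : y \in J. Proof. by case: mv. Qed.

Let convexJ (a c e : 'I_r) : a \in J -> e \in J -> c \in Y -> (a <= c <= e)%N -> c \in J.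
Proof.
case: mv => _ _ _ H _ aJ eJ cY; apply: H => //.
by rewrite inE cY orbT.
Qed.

(** The relocated [j] and [y] enclose the margin, so by convexity of the block all its keys move,
    each standing for mass at most [Q]. *)
Lemma swallow_l j x l : x \in Y -> l \in Y -> (x <= l)%N -> (l < y)%N ->
  j \in J -> (j <= x)%N -> mass x l <= Q * #|block_l x l|%:R.
Proof.
move=> xY lY xl ly jJ jx; apply: le_trans (mass_le_keys lam_ge0 (ltW Q_gt0) sgY xY lY xl) _.
rewrite ler_pM2l // ler_nat; apply/subset_leq_card/subsetP => v; rewrite !inE.
by move=> /andP[vY hv]; rewrite hv andbT; apply: (convexJ jJ yJ vY); order_lia.
Qed.

Lemma keys_shift x z : x \in Y -> z \in Y -> (x <= z)%N ->
  keys Y x z = #|[set v in Y | (x <= v < z)%N]|.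
Proof.
move=> xY zY; rewrite leq_eqVlt => /orP[/eqP/ord_inj ->|xz].
  by rewrite keysxx; apply/esym/eqP; rewrite cards_eq0; apply/eqP/setP => v; rewrite !inE;
    case: (v \in Y) => //=; order_lia.
have xNz : x != z by apply/eqP => e; move: xz; rewrite e ltnn.
apply/eqP; rewrite -(eqn_add2l 1); apply/eqP.
transitivity #|[set v in Y | (x <= v <= z)%N]|.
  rewrite (cardsD1 x [set v in Y | (x <= v <= z)%N]) !inE xY leqnn (ltnW xz) /=; congr (_ + _)%N.
  apply: eq_card => v; rewrite !inE; case: eqVneq => [->|/eqP vx] /=; first by rewrite ltnn andbF.
  case: (v \in Y) => //=; have {}vx : (v : nat) <> x by move=> e; apply: vx; apply: ord_inj.
  by rewrite ltn_neqAle eq_sym; move/eqP: vx => ->.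
rewrite (cardsD1 z [set v in Y | (x <= v <= z)%N]) !inE zY leqnn (ltnW xz) /=; congr (_ + _)%N.
apply: eq_card => v; rewrite !inE; case: eqVneq => [->|/eqP vx] /=; first by rewrite ltnn !andbF.
case: (v \in Y) => //=; have {}vx : (v : nat) <> z by move=> e; apply: vx; apply: ord_inj.
by rewrite (ltn_neqAle v z); move/eqP: vx => ->.
Qed.

Lemma swallow_r j x z : x \in Y -> z \in Y -> (x <= z)%N -> (y < x)%N ->
  j \in J -> (z <= j)%N -> mass x z <= Q * #|block_r x z|%:R.
Proof.
move=> xY zY xz yx jJ zj; apply: le_trans (mass_le_keys lam_ge0 (ltW Q_gt0) sgY xY zY xz) _.
rewrite ler_pM2l // ler_nat keys_shift //; apply/subset_leq_card/subsetP => v; rewrite !inE.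
by move=> /andP[vY hv]; rewrite hv andbT; apply: (convexJ yJ jJ vY); order_lia.
Qed.

(** [l'] is the last key of the margin that stays: nothing left of it moves, by convexity, and all
    beyond it does. If [x] itself moves, [l' = x] records that the whole margin is lost. *)
Lemma margin_l x l : x \in Y -> l \in Y -> (x <= l)%N -> (l < y)%N ->
  exists l', [/\ l' \in Y, (x <= l' <= l)%N, mass l' l <= Q * #|block_l x l|%:R
    & (x < l')%N -> forall v, v \in Y -> (x <= v <= l')%N -> v \notin J].
Proof.
move=> xY lY xl ly; have [xJ|xJ] := boolP (x \in J).
  exists x; split; rewrite ?leqnn //; last by rewrite ltnn.
  exact: (swallow_l xY lY xl ly xJ).
pose Pr v := [&& v \in Y, v \notin J & (x <= v <= l)%N].
have Px : Pr x by rewrite /Pr xY xJ leqnn xl.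
case: (@arg_maxnP _ x Pr (fun v : 'I_r => v : nat) Px) => l' /and3P[lY' lJ' hl] H.
have [h1 h2] := andP hl.
exists l'; split=> //.
  apply: le_trans (mass_le_keys lam_ge0 (ltW Q_gt0) sgY lY' lY h2) _.
  rewrite ler_pM2l // ler_nat; apply/subset_leq_card/subsetP => v; rewrite !inE.
  move=> /andP[vY hv]; have -> : (x < v <= l)%N by order_lia.
  rewrite andbT; apply/negPn/negP => vJ; have := H v; rewrite /Pr vY vJ.
  have -> : (x <= v <= l)%N by order_lia.
  by move=> /(_ isT) /=; order_lia.
move=> _ v vY hv; apply: contra lJ' => vJ.
by apply: (convexJ vJ yJ lY'); order_lia.
Qed.

Lemma margin_r x z : x \in Y -> z \in Y -> (x <= z)%N -> (y < x)%N ->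
  exists l', [/\ l' \in Y, (x <= l' <= z)%N, mass x l' <= Q * #|block_r x z|%:R
    & (l' < z)%N -> forall v, v \in Y -> (l' <= v <= z)%N -> v \notin J].
Proof.
move=> xY zY xz yx; have [zJ|zJ] := boolP (z \in J).
  exists z; split; rewrite ?leqnn ?andbT //; last by rewrite ltnn.
  exact: (swallow_r xY zY xz yx zJ).
pose Pr v := [&& v \in Y, v \notin J & (x <= v <= z)%N].
have Pz : Pr z by rewrite /Pr zY zJ leqnn xz.
case: (@arg_minnP _ z Pr (fun v : 'I_r => v : nat) Pz) => l' /and3P[lY' lJ' hl] H.
have [h1 h2] := andP hl.
exists l'; split=> //.
  apply: le_trans (mass_le_keys lam_ge0 (ltW Q_gt0) sgY xY lY' h1) _.
  rewrite ler_pM2l // ler_nat keys_shift //; apply/subset_leq_card/subsetP => v; rewrite !inE.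
  move=> /andP[vY hv]; have -> : (x <= v < z)%N by order_lia.
  rewrite andbT; apply/negPn/negP => vJ; have := H v; rewrite /Pr vY vJ.
  have -> : (x <= v <= z)%N by order_lia.
  by move=> /(_ isT) /=; order_lia.
move=> _ v vY hv; apply: contra lJ' => vJ.
by apply: (convexJ yJ vJ lY'); order_lia.
Qed.

End LazyMoves.

(** * Chains of nested intervals *)

(* A node is an interval [nx .. nz] of stored keys with two margins [nx .. nl]
   and [nr .. nz] that no relocation has touched since the node was chosen;
   [nm] is its mass at that moment and [nk] the number of keys inserted into it
   since then. *)
Record node (R : Type) (r : nat) :=
  Node {nx : 'I_r; nl : 'I_r; nr : 'I_r; nz : 'I_r; nm : R; nk : nat}.

Section Chains.
Variables (R : realType) (m r : nat) (lam Q b C T : R) (N : nat).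
Implicit Types (Y J : {set 'I_r}) (g : 'I_r -> nat) (x y z : 'I_r).
Local Notation mass := (@mass R r lam).
Local Notation len := (@len R r).
Local Notation short_gaps := (@short_gaps R r lam Q).
Local Notation node := (node R r).
Implicit Types (P V : node).

Definition fat Y g x z : R := mass Y x z * (mass Y x z / len g x z) ^+ N.

Definition cur Y P := mass Y (nx P) (nz P).
Definition nlen g P := len g (nx P) (nz P).

(** The density bounds, multiplied out, refer to the initial mass [nm P] and to the margins only, so
    they survive insertions into the core and the shrinking of a margin. *)
Definition node_ok Y g P :=
  [/\ [/\ nx P \in Y, nl P \in Y, nr P \in Y & nz P \in Y],
      [/\ (nx P < nl P)%N, (nl P < nr P)%N & (nr P < nz P)%N],
      T <= nm P /\ cur Y P = nm P + (nk P)%:R,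
      nm P / 16 <= mass Y (nx P) (nl P) <= nm P / 8 /\
      nm P / 16 <= mass Y (nr P) (nz P) <= nm P / 8
    & (forall y, y \in Y -> (nx P < y <= nl P)%N -> nm P / 16 <= mass Y (nx P) y ->
         mass Y (nx P) y * nlen g P <= b * nm P * len g (nx P) y) /\
      (forall y, y \in Y -> (nr P <= y < nz P)%N -> nm P / 16 <= mass Y y (nz P) ->
         mass Y y (nz P) * nlen g P <= b * nm P * len g y (nz P))].

(* Up to now [P] and [V] have received the same keys since [V] was chosen, so
   [cur Y P - nk V] is the mass that [P] had at that moment. *)
Definition link Y g P V :=
  [/\ (nl P <= nx V)%N /\ (nz V <= nr P)%N,
      2 * nm V <= cur Y P - (nk V)%:R,
      (cur Y P - (nk V)%:R) / nlen g P <= b * (nm V / nlen g V)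
    & (cur Y P - (nk V)%:R) * ((cur Y P - (nk V)%:R) / nlen g P) ^+ N
        <= C * (nm V * (nm V / nlen g V) ^+ N)].

(* How much mass the margins of [P] have lost, up to an error of [2 * Q]. *)
Definition worn Y P := (nm P / 8 - mass Y (nx P) (nl P)) + (nm P / 8 - mass Y (nr P) (nz P)).

Hypotheses (lam_ge0 : 0 <= lam) (Q_gt0 : 0 < Q) (N_gt0 : (0 < N)%N).
Hypotheses (b_ge1 : 1 <= b) (b_N : 16 <= b ^+ N) (CE : C = 4 * b ^+ N) (QT : 64 * Q <= T).

(** The node is the fattest interval between [p] and [q], with about an eighth of its mass cut off
    at each side; the last premise makes it heavy enough for cutting. *)
Lemma fat_select Y g p q : placed m Y g -> short_gaps Y ->
  p \in Y -> q \in Y -> (p < q)%N ->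
  (forall x z, x \in Y -> z \in Y -> (x < z)%N ->
     fat Y g p q <= fat Y g x z -> T <= mass Y x z) ->
  exists V, [/\ node_ok Y g V, (p <= nx V)%N /\ (nz V <= q)%N, nk V = 0%N,
     fat Y g p q <= fat Y g (nx V) (nz V) & worn Y V <= 2 * Q].
Proof.
move=> pY sg pYk qYk pq HT.
pose Pr (u : 'I_r * 'I_r) := [&& u.1 \in Y, u.2 \in Y & (p <= u.1 < u.2)%N && (u.2 <= q)%N].
pose Fu (u : 'I_r * 'I_r) := fat Y g u.1 u.2.
have P0 : Pr (p, q) by rewrite /Pr /= pYk qYk leqnn pq leqnn.
case: (@Order.TotalTheory.arg_maxP _ R _ (p, q) Pr Fu P0) => -[x z].
move=> /and3P/=[xY zY /andP[/andP[px xz] zq]] H.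
have fmax u v : u \in Y -> v \in Y -> (x <= u)%N -> (u < v)%N -> (v <= z)%N ->
    fat Y g u v <= fat Y g x z.
  move=> uY vY xu uv vz; apply: (H (u, v)); rewrite /Pr /= uY vY.
  by rewrite (leq_trans px xu) uv (leq_trans vz zq).
have fpq : fat Y g p q <= fat Y g x z by apply: (H (p, q)).
set M := mass Y x z.
have TM : T <= M by apply: HT.
have M_gt0 : 0 < M by move: TM QT Q_gt0; lra.
have tau1 : 0 <= M / 8 <= mass Y x z by rewrite -/M; lra.
(* The extra [Q] absorbs the rounding of [mass_split], so that the right margin weighs at most
   [M / 8]. *)
have tau2 : 0 <= 7 * M / 8 + Q <= mass Y x z by rewrite -/M; move: TM QT Q_gt0; lra.
have [l [lY hl Ml]] := mass_split (ltW Q_gt0) sg xY zY (ltnW xz) tau1.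
have [w [rY hr Mr]] := mass_split (ltW Q_gt0) sg xY zY (ltnW xz) tau2.
have Mr' := massD lam Y hr; rewrite -/M in Mr'.
have xl : (x < l)%N.
  rewrite ltn_neqAle; case/andP: hl => -> _; rewrite andbT; apply/eqP => /ord_inj e.
  by move: Ml TM QT Q_gt0; rewrite -e massxx; lra.
have rz : (w < z)%N.
  rewrite ltn_neqAle; case/andP: hr => _ ->; rewrite andbT; apply/eqP => /ord_inj e.
  by move: Mr TM QT Q_gt0; rewrite e -/M; lra.
have lr : (l < w)%N.
  rewrite ltnNge; apply/negP => rl.
  have := mass_ge0 lam_ge0 Y rl; have hxrl : (x <= w <= l)%N by rewrite rl andbT; case/andP: hr.
  have := massD lam Y hxrl; move: Mr Ml TM QT Q_gt0; lra.
have sM := len_gt0 R pY xY zY xz.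
(* A subinterval of mass at least [M / 16] denser than [b * dens] would be fatter. *)
have key u v : u \in Y -> v \in Y -> (x <= u)%N -> (u < v)%N -> (v <= z)%N ->
    M / 16 <= mass Y u v -> mass Y u v * len g x z <= b * M * len g u v.
  move=> uY vY xu uv vz Muv; have suv := len_gt0 R pY uY vY uv.
  rewrite leNgt; apply/negP => hd.
  have hd' : b * (M / len g x z) < mass Y u v / len g u v.
    by rewrite ltr_pdivlMr // mulrA mulrAC ltr_pdivrMr.
  have D0 : 0 < M / len g x z by rewrite divr_gt0.
  have := fmax u v uY vY xu uv vz; rewrite leNgt => /negP; apply.
  rewrite /fat -/M; set D := M / _ in hd' D0 *; set E := _ / len g u v in hd' *.
  clearbody D E.
  have hp : (b * D) ^+ N < E ^+ N.
    have bD0 : 0 <= b * D by rewrite mulr_ge0 ?(ltW D0) ?(le_trans _ b_ge1).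
    by rewrite (ltrXn2r N bD0 hd') -lt0n.
  have DN : 0 < D ^+ N by rewrite exprn_gt0.
  have hp' : 16 * D ^+ N < E ^+ N.
    by apply: le_lt_trans hp; rewrite exprMn ler_pM2r.
  apply: (@lt_le_trans _ _ (M / 16 * E ^+ N)).
    by move: hp'; set X := D ^+ N; set Z := E ^+ N; move=> hp'; nra.
  by rewrite ler_wpM2r //; move: DN hp'; lra.
exists (Node x l w z M 0); split=> //=; last first.
  by rewrite /worn /=; move: Ml Mr Mr'; lra.
split=> //=.
- by split=> //; rewrite /cur /= addr0.
- by move: Ml Mr Mr' TM QT Q_gt0; lra.
- rewrite /nlen /=; split=> y yY /andP[h1 h2] h3; apply: key => //.
  + by apply: leq_trans h2 _; case/andP: hl.
  + by apply: leq_trans h1; case/andP: hr.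
Qed.

Lemma nm_gt0 Y g P : node_ok Y g P -> 0 < nm P.
Proof. by case=> _ _ [h _] _ _; move: h QT Q_gt0; lra. Qed.

Lemma node_lt Y g P : node_ok Y g P -> (nx P < nz P)%N.
Proof. by case=> _ [h1 h2 h3] _ _ _; apply: ltn_trans h1 (ltn_trans h2 h3). Qed.

Lemma nlen_gt0 Y g P : placed m Y g -> node_ok Y g P -> 0 < nlen g P.
Proof. by move=> pY oP; apply: (len_gt0 R pY); [case: oP => -[]..|exact: node_lt oP]. Qed.

Lemma node_massE Y g P : node_ok Y g P ->
  cur Y P = mass Y (nx P) (nl P) + mass Y (nl P) (nr P) + mass Y (nr P) (nz P).
Proof.
case=> _ [h1 h2 h3] _ _ _; rewrite /cur -addrA -!massD //; apply/andP; split; order_lia.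
Qed.

Lemma core_mass Y g P : node_ok Y g P ->
  3 / 4 * cur Y P <= mass Y (nl P) (nr P) <= cur Y P - nm P / 8.
Proof.
move=> oP; have := node_massE oP; case: oP => _ _ [_ e] [h1 h2] _.
have : 0 <= (nk P)%:R :> R by []; move: e h1 h2; lra.
Qed.

(* Removing margins that are at most [b] times denser than the node costs at
   most a factor [b] in density, since they carry at most half of its mass. *)
Lemma core_density Y g P : placed m Y g -> node_ok Y g P ->
  cur Y P * len g (nl P) (nr P) <= b * mass Y (nl P) (nr P) * nlen g P.
Proof.
move=> pY oP; have eM := node_massE oP; have cM := core_mass oP.
have s0 := nlen_gt0 pY oP; have M0 := nm_gt0 oP.
case: oP => -[xY lY rY zY] [h1 h2 h3] [hT e] [m1 m2] [g1 g2].
have k0 : 0 <= (nk P)%:R :> R by [].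
have := g1 _ lY; rewrite h1 leqnn => /(_ isT); case/andP: m1 => m1 m1' /(_ m1) G1.
have := g2 _ rY; rewrite h3 leqnn => /(_ isT); case/andP: m2 => m2 m2' /(_ m2) G2.
have eL : nlen g P = len g (nx P) (nl P) + len g (nl P) (nr P) + len g (nr P) (nz P).
  by rewrite /nlen (lenD _ g (nx P) (nl P) (nz P)) (lenD _ g (nl P) (nr P) (nz P)) addrA.
have L1 := len_gt0 R pY xY lY h1; have L2 := len_gt0 R pY lY rY h2.
have L3 := len_gt0 R pY rY zY h3.
move: e eM cM eL s0 M0 k0 G1 G2 m1 m1' m2 m2' L1 L2 L3.
set c := cur Y P; set s := nlen g P; set M := nm P; set k : R := (nk P)%:R.
set a1 := mass _ _ _; set a2 := mass _ _ _; set a3 := mass _ _ _.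
set l1 := len _ _ _; set l2 := len _ _ _; set l3 := len _ _ _.
move=> e eM cM eL s0 M0 k0 G1 G2 m1 m1' m2 m2' L1 L2 L3.
have c0 : 0 < c by lra.
have b1 := b_ge1.
have H1 : (a1 + a3) * s <= b * c * (l1 + l3).
  have : b * M * (l1 + l3) <= b * c * (l1 + l3).
    by apply: ler_wpM2r; [lra | apply: ler_wpM2l; lra].
  by move: G1 G2; lra.
set u := a1 + a3 in H1; have hu : 0 <= u <= c / 2 by rewrite /u; lra.
have -> : l2 = s - (l1 + l3) by lra.
have -> : a2 = c - u by rewrite /u; lra.
set L := l1 + l3 in H1 *.
have b0 : 0 < b by lra.
rewrite -(ler_pM2l b0).
(* The difference of the two sides is [s * ((b - 1) * (b * c - u * (b + 1)))], nonnegative because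
   [u <= c / 2]. *)
have h4 : b * (c * s) - u * s <= b * (b * ((c - u) * s)).
  have : 0 <= s * ((b - 1) * (b * c - u * (b + 1))).
    apply: mulr_ge0; first exact: ltW.
    apply: mulr_ge0; first lra.
    rewrite subr_ge0.
    apply: (@le_trans _ _ (c / 2 * (b + 1))); first by rewrite ler_wpM2r; lra.
    have : 0 <= c * (b - 1) by apply: mulr_ge0; lra.
    by lra.
  by move=> h; rewrite -subr_ge0; apply: le_trans h _; rewrite le_eqVlt; apply/orP; left; apply/eqP; ring.
by move: H1 h4; lra.
Qed.

(** A subinterval has no more mass, so it can be at least as fat only by being at least as dense. *)
Lemma dens_le_of_fat Y g x z p q : placed m Y g -> x \in Y -> z \in Y ->
  p \in Y -> q \in Y -> (p <= x)%N -> (x < z)%N -> (z <= q)%N ->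
  fat Y g p q <= fat Y g x z -> mass Y p q / len g p q <= mass Y x z / len g x z.
Proof.
move=> pY xY zY pYk qYk px xz zq; rewrite /fat => h.
have pq : (p < q)%N by order_lia.
have M1 := mass_ge1 lam_ge0 zY xz; have M2 := mass_ge1 lam_ge0 qYk pq.
have L1 := len_gt0 R pY xY zY xz; have L2 := len_gt0 R pY pYk qYk pq.
have Mle : mass Y x z <= mass Y p q.
  have hx : (p <= x <= q)%N by order_lia.
  have hz : (x <= z <= q)%N by order_lia.
  have pxx := mass_ge0 lam_ge0 Y px; have zqq := mass_ge0 lam_ge0 Y zq.
  by rewrite (massD lam Y hx) (massD lam Y hz); move: pxx zqq; lra.
rewrite -(ler_pXn2r N_gt0) ?nnegrE; [|by apply: divr_ge0; lra..].
set D := mass Y p q / _ in h *; set E := mass Y x z / _ in h *.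
have E0 : 0 <= E ^+ N by apply: exprn_ge0; apply: divr_ge0; lra.
rewrite -(@ler_pM2l _ (mass Y p q)); last lra.
by apply: le_trans h _; rewrite ler_wpM2r.
Qed.

Lemma child_exists Y g P : placed m Y g -> short_gaps Y -> node_ok Y g P ->
  (forall x z, x \in Y -> z \in Y -> (x < z)%N ->
     fat Y g (nx P) (nz P) <= C * fat Y g x z -> T <= mass Y x z) ->
  exists V, [/\ node_ok Y g V, link Y g P V, nk V = 0%N & worn Y V <= 2 * Q].
Proof.
move=> pY sg oP HT.
have cM := core_mass oP; have cD := core_density pY oP.
have s0 := nlen_gt0 pY oP; have M0 := nm_gt0 oP.
have [-[xY lY rY zY] [h1 h2 h3] [hT e] _ _] := oP.
have k0 : 0 <= (nk P)%:R :> R by [].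
have b1 := b_ge1; have Q0 := Q_gt0; have hQT := QT.
set c := cur Y P in cM cD e; set A := mass Y (nl P) (nr P) in cM cD.
have c0 : T <= c by lra.
have tau : 0 <= A / 2 <= mass Y (nl P) (nr P) by rewrite -/A; move: cM; lra.
have [y [yY /andP[hy1 hy2] My]] := mass_split (ltW Q_gt0) sg lY rY (ltnW h2) tau.
have hy : (nl P <= y <= nr P)%N by rewrite hy1.
have eA := massD lam Y hy; rewrite -/A in eA.
have ly : (nl P < y)%N.
  rewrite ltn_neqAle hy1 andbT; apply/eqP => /ord_inj e'.
  by move: My c0 QT Q_gt0 cM; rewrite -e' massxx; lra.
have yr : (y < nr P)%N.
  rewrite ltn_neqAle hy2 andbT; apply/eqP => /ord_inj e'.
  by move: My c0 QT Q_gt0 cM; rewrite e' -/A; lra.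
have sc := len_gt0 R pY lY rY h2.
(* Halve the core by mass; by averaging, one half is at least as dense as the core. *)
have [p [q [[pYk qYk pq] [lp qr] Mpq Dpq]]] : exists p q, [/\ [/\ p \in Y, q \in Y & (p < q)%N],
    (nl P <= p)%N /\ (q <= nr P)%N, A / 2 - Q <= mass Y p q <= A / 2 + Q
    & A * len g p q <= mass Y p q * len g (nl P) (nr P)].
  have [hh|hh] := leP (A * len g (nl P) y) (mass Y (nl P) y * len g (nl P) (nr P)).
    by exists (nl P), y; split=> //; move: My; lra.
  exists y, (nr P); split=> //; first by move: My eA; lra.
  move: hh; rewrite (lenD R g (nl P) y (nr P)) {1 2}eA.
  set L1 := len g _ y; set L2 := len g y _; set A1 := mass Y _ y; set A2 := mass Y y _.
  by lra.
have spq := len_gt0 R pY pYk qYk pq.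
have cA : c / 4 <= mass Y p q by move: Mpq cM c0 QT Q_gt0; lra.
have A0 : 0 < A by move: cM c0 QT Q_gt0; lra.
have D1 : c / nlen g P <= b * (mass Y p q / len g p q).
  rewrite mulrA ler_pdivlMr // mulrAC ler_pdivrMr // -(ler_pM2r sc).
  have := ler_wpM2r (ltW spq) cD.
  have bs : 0 <= b * nlen g P by apply: mulr_ge0; lra.
  by have := ler_wpM2l bs Dpq; lra.
(* The half has at least a quarter of the mass of [P] and loses at most a factor [b] of density,
   whence [C = 4 * b ^+ N]. *)
have F1 : fat Y g (nx P) (nz P) <= C * fat Y g p q.
  rewrite /fat -/(cur Y P) -/c -/(nlen g P) CE.
  have dp0 : 0 <= c / nlen g P by apply: divr_ge0; lra.
  have : (c / nlen g P) ^+ N <= b ^+ N * (mass Y p q / len g p q) ^+ N.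
    by rewrite -exprMn lerXn2r ?nnegrE // (le_trans dp0).
  move=> hN; apply: le_trans (ler_wpM2l _ hN) _; first lra.
  have : 0 <= b ^+ N * (mass Y p q / len g p q) ^+ N by apply: le_trans hN; apply: exprn_ge0.
  rewrite [X in _ -> _ <= X](_ : _ = 4 * mass Y p q * (b ^+ N * (mass Y p q / len g p q) ^+ N)); last by ring.
  by move=> hb; rewrite ler_wpM2r //; lra.
have C0 : 0 < C by rewrite CE; move: b_N; lra.
have [x z xx zz xz fx|V [oV [pV Vq] kV fV wV]] := fat_select pY sg pYk qYk pq.
  by apply: HT => //; apply: le_trans F1 _; rewrite ler_pM2l.
have xzV := node_lt oV; have [-[xV _ _ zV] _ [TV eV] _ _] := oV.
have cV : cur Y V = nm V by rewrite eV kV addr0.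
exists V; split=> //; split.
- by split; [apply: leq_trans lp pV | apply: leq_trans Vq qr].
(* The margins, missing from the core, absorb the error [Q] of the halving. *)
- rewrite kV subr0 -/c -cV.
  have hx : (p <= nx V <= q)%N by order_lia.
  have hz : (nx V <= nz V <= q)%N by order_lia.
  have := massD lam Y hx; rewrite (massD lam Y hz) -/(cur Y V).
  have := mass_ge0 lam_ge0 Y pV; have := mass_ge0 lam_ge0 Y Vq.
  by move: Mpq cM hT QT; lra.
- rewrite kV subr0 -/c -cV; apply: le_trans D1 _; rewrite ler_wpM2l //; first lra.
  exact: dens_le_of_fat fV.
- rewrite kV subr0 -/c -cV; apply: le_trans F1 _.
  by rewrite ler_pM2l.
Qed.

(** * Ageing and the potential of a chain *)

Variables (theta : R).
Hypotheses (theta_ge1 : 1 <= theta) (theta_T : theta <= T).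

Fixpoint chain Y g P (s : seq node) :=
  if s is V :: s' then [/\ link Y g P V, node_ok Y g V & chain Y g V s'] else True.

Definition young V := theta * (nk V)%:R < nm V.

(** Every key received while young adds [theta]; the extra [theta] in the cap leaves room for the
    key that makes the interval old. *)
Definition credit V := Num.min (theta * (nk V)%:R) (nm V + theta).

(* [credit V] is what the age of [V] still has to be paid for by relocations,
   [64 * worn Y V] what has been paid already. *)
Definition pot Y V := credit V - 64 * (worn Y V - 2 * Q).

Definition pots Y s := \sum_(V <- s) pot Y V.

Definition inside y P := (nl P < y < nr P)%N.

Variables (D0 F0 : R) (d : nat).
Hypothesis (F0_ge : T * C ^+ d * Q ^+ N <= F0).

(** [i] is the depth in the chain: each level may lose a factor [b] of density and a factor [C] of
    fatness. *)
Definition good Y g i P :=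
  D0 <= b ^+ i * (cur Y P / nlen g P) /\ F0 <= C ^+ i * fat Y g (nx P) (nz P).

Let C_ge1 : 1 <= C.
Proof. by rewrite CE; move: b_N; lra. Qed.

(** Densities are at most [Q], so fatness [T * Q ^+ N] requires mass [T]; [F0] has room for the
    factors [C] lost on [d] levels. *)
Lemma mass_large Y g i x z : placed m Y g -> short_gaps Y -> (i <= d)%N ->
  x \in Y -> z \in Y -> (x < z)%N -> F0 <= C ^+ i * fat Y g x z -> T <= mass Y x z.
Proof.
move=> pY sg id xY zY xz hF.
have Q0 := ltW Q_gt0.
have M1 := mass_ge1 lam_ge0 zY xz; have L1 := len_gt0 R pY xY zY xz.
have dQ : mass Y x z / len g x z <= Q.
  rewrite ler_pdivrMr //; apply: le_trans (mass_le_keys lam_ge0 Q0 sg xY zY (ltnW xz)) _.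
  by rewrite ler_pM2l //; apply: (keys_le_len lam_ge0 Q0 pY) => //; exact: ltnW.
have d0 : 0 <= mass Y x z / len g x z by apply: divr_ge0; lra.
have hN : (mass Y x z / len g x z) ^+ N <= Q ^+ N by rewrite lerXn2r ?nnegrE.
have QN : 0 < Q ^+ N by rewrite exprn_gt0.
have Ci : C ^+ i <= C ^+ d by apply: ler_weXn2l.
have Cd : 0 < C ^+ d by rewrite exprn_gt0 // (lt_le_trans ltr01 C_ge1).
have M0 : 0 <= mass Y x z by lra.
have : T * C ^+ d * Q ^+ N <= mass Y x z * C ^+ d * Q ^+ N.
  apply: le_trans F0_ge (le_trans hF _).
  have -> : mass Y x z * C ^+ d * Q ^+ N = C ^+ d * (mass Y x z * Q ^+ N) by ring.
  apply: ler_pM => //.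
  - by apply: exprn_ge0; apply: le_trans C_ge1.
  - by apply: mulr_ge0 => //; apply: exprn_ge0.
  - by apply: ler_wpM2l.
by rewrite !ler_pM2r.
Qed.

(** Receiving the same [k] keys multiplies the density of the parent by [1 + k / A] and that of the
    child by [1 + k / M], so the comparison made at selection persists, with a gain [c]. *)
Lemma link_ratio (A M k sP sV c : R) : 0 < M -> 2 * M <= A -> 0 <= k -> 0 < sP -> 0 < sV ->
  0 <= c -> c * (1 + k / A) <= 1 + k / M -> A / sP <= b * (M / sV) ->
  (A + k) / sP * c <= b * ((M + k) / sV).
Proof.
move=> M0 MA k0 sP0 sV0 c0 hc h; have A0 : 0 < A by lra.
have -> : (A + k) / sP * c = A / sP * (c * (1 + k / A)) by field; rewrite !gt_eqF.
have -> : b * ((M + k) / sV) = b * (M / sV) * (1 + k / M) by field; rewrite !gt_eqF.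
apply: ler_pM => //; first by apply: divr_ge0; lra.
by apply: mulr_ge0 => //; apply: addr_ge0 => //; apply: divr_ge0; lra.
Qed.

Lemma age_ratio (A M k : R) : 0 < M -> 2 * M <= A -> 0 <= k -> 1 + k / A <= 1 + k / M.
Proof.
by move=> M0 MA k0; rewrite lerD2l ler_wpM2l // lef_pV2 ?posrE; lra.
Qed.

(** With [K = k / M], the parent gains at most [K / 2], and [1 / theta] is at most both [1] and [K],
    so the left side is at most [1 + K / 2 + K / 3 + K / 6]. *)
Lemma old_ratio (A M k : R) : 0 < M -> 2 * M <= A -> M <= theta * k ->
  (1 + 1 / (3 * theta)) * (1 + k / A) <= 1 + k / M.
Proof.
move=> M0 MA kM; have t0 : 0 < theta by move: theta_ge1; lra.
have k0 : 0 < k by move: (lt_le_trans M0 kM); rewrite pmulr_rgt0.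
have hA : k / A <= k / M / 2.
  have -> : k / M / 2 = k / (2 * M) by field; rewrite gt_eqF.
  by apply: ler_wpM2l; [exact: ltW | rewrite lef_pV2 ?posrE; lra].
set ti := 1 / theta; have -> : 1 / (3 * theta) = ti / 3 by rewrite /ti; field; rewrite gt_eqF.
have ti1 : ti <= 1 by rewrite /ti ler_pdivrMr // mul1r.
have ti0 : 0 < ti by rewrite /ti divr_gt0.
have kap : ti <= k / M by rewrite /ti ler_pdivrMr // mulrAC ler_pdivlMr // mul1r mulrC.
set K := k / M in hA kap *; set K' := k / A in hA *.
have : 0 <= (1 + ti / 3) * (K / 2 - K') by apply: mulr_ge0; lra.
have : 0 <= K * (1 - ti) by apply: mulr_ge0; lra.
by lra.
Qed.

Lemma link_bounds Y g P V : placed m Y g -> node_ok Y g P -> node_ok Y g V -> link Y g P V ->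
  [/\ cur Y P / nlen g P <= b * (cur Y V / nlen g V),
      fat Y g (nx P) (nz P) <= C * fat Y g (nx V) (nz V)
    & ~~ young V -> cur Y P / nlen g P * (1 + 1 / (3 * theta)) <= b * (cur Y V / nlen g V)].
Proof.
move=> pY oP oV [_ hM hD hF]; have sP := nlen_gt0 pY oP; have sV := nlen_gt0 pY oV.
have M0 := nm_gt0 oV; have [_ _ [_ eV] _ _] := oV.
move: hM hD hF sP sV M0; set k := (nk V)%:R : R; set A := cur Y P - k.
rewrite /fat -/(cur Y P) -/(cur Y V) -/(nlen g P) -/(nlen g V) eV -/k.
have -> : cur Y P = A + k by rewrite /A subrK.
set M := nm V; set u := nlen g P; set v := nlen g V.
move=> hM hD hF sP sV M0; have k0 : 0 <= k by [].
have A0 : 0 < A by lra.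
have h1 := age_ratio M0 hM k0.
split.
- by have := link_ratio M0 hM k0 sP sV ler01; rewrite mul1r mulr1; apply.
- have e1 : (A + k) * ((A + k) / u) ^+ N = A * (A / u) ^+ N * (1 + k / A) ^+ N.+1.
    rewrite exprS (_ : (A + k) / u = A / u * (1 + k / A)); last by field; rewrite !gt_eqF.
    by rewrite exprMn; field; rewrite gt_eqF.
  have e2 : (M + k) * ((M + k) / v) ^+ N = M * (M / v) ^+ N * (1 + k / M) ^+ N.+1.
    rewrite exprS (_ : (M + k) / v = M / v * (1 + k / M)); last by field; rewrite !gt_eqF.
    by rewrite exprMn; field; rewrite gt_eqF.
  rewrite e1 e2 mulrA; have a0 : 0 <= 1 + k / A by apply: addr_ge0 => //; apply: divr_ge0; lra.
  apply: ler_pM => //.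
  + by apply: mulr_ge0; [lra | apply: exprn_ge0; apply: divr_ge0; lra].
  + exact: exprn_ge0.
  + by rewrite lerXn2r ?nnegrE // (le_trans a0).
- rewrite /young -leNgt -/k -/M => hk.
  apply: link_ratio => //; last exact: old_ratio.
  by apply: addr_ge0 => //; apply: divr_ge0 => //; move: theta_ge1; lra.
Qed.

Lemma link_good Y g i P V : placed m Y g -> node_ok Y g P -> node_ok Y g V -> link Y g P V ->
  good Y g i P -> good Y g i.+1 V.
Proof.
move=> pY oP oV lPV [h1 h2]; have [l1 l2 _] := link_bounds pY oP oV lPV.
split.
  apply: le_trans h1 _; rewrite exprSr -mulrA ler_wpM2l //.
  by apply: exprn_ge0; apply: le_trans b_ge1.
apply: le_trans h2 _; rewrite exprSr -mulrA ler_wpM2l //.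
by apply: exprn_ge0; apply: le_trans C_ge1.
Qed.

(** New nodes have no credit and are worn by at most the tolerated [2 * Q], so a fresh tail has
    nonnegative potential. *)
Lemma chain_extend Y g j i P : placed m Y g -> short_gaps Y -> (i + j <= d)%N ->
  node_ok Y g P -> good Y g i P ->
  exists s, [/\ size s = j, chain Y g P s & 0 <= pots Y s].
Proof.
move=> pY sg; elim: j i P => [|j IH] i P ij oP gP.
  by exists [::]; split=> //; rewrite /pots big_nil.
have [x z xY zY xz hf|V [oV lV kV wV]] := child_exists pY sg oP.
  apply: (@mass_large Y g i.+1) => //; first by order_lia.
  case: gP => _ h; apply: le_trans h _; rewrite exprSr -mulrA ler_wpM2l //.
  by apply: exprn_ge0; apply: le_trans C_ge1.
have [||s [ss cs ps]] := IH i.+1 V _ oV; first by order_lia.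
  exact: link_good lV gP.
exists (V :: s); split=> /=; rewrite ?ss //.
rewrite /pots big_cons addr_ge0 //.
rewrite /pot /credit kV mulr0 subr_ge0 (@le_trans _ _ 0) //.
  by move: wV; lra.
rewrite le_min lexx /=; have := nm_gt0 oV; move: theta_ge1; lra.
Qed.

(** Each link loses at most [b] and each old node gains [1 + 1 / (3 * theta)]; as the final density
    is bounded, this limits the number of old nodes. *)
Lemma chain_old Y g P s : placed m Y g -> node_ok Y g P -> chain Y g P s ->
  cur Y P / nlen g P * (1 + 1 / (3 * theta)) ^+ count (predC young) s
    <= b ^+ size s * (cur Y (last P s) / nlen g (last P s)).
Proof.
move=> pY; have t0 : 0 <= 1 + 1 / (3 * theta).
  by apply: addr_ge0 => //; apply: divr_ge0 => //; move: theta_ge1; lra.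
elim: s P => [|V s IH] P oP /=; first by rewrite !mul1r mulr1.
move=> [lV oV cV]; have [l1 _ l2] := link_bounds pY oP oV lV.
rewrite exprS -[X in _ <= X]mulrA; have b0 : 0 <= b by apply: le_trans b_ge1.
apply: le_trans (ler_wpM2l b0 (IH V oV cV)); rewrite mulrA exprD mulrA.
rewrite ler_wpM2r ?exprn_ge0 //.
by case: (boolP (young V)) => h; rewrite /= ?expr0 ?expr1 ?mulr1 //; exact: l2.
Qed.

Lemma chain_good Y g i P s : placed m Y g -> node_ok Y g P -> chain Y g P s ->
  good Y g i P -> node_ok Y g (last P s) /\ good Y g (i + size s) (last P s).
Proof.
move=> pY; elim: s i P => [|V s IH] i P oP /=; first by rewrite addn0.
move=> [lV oV cV] gP; rewrite addnS -addSn; apply: IH => //; exact: link_good lV gP.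
Qed.

Lemma chain_inside Y g y P s : node_ok Y g P -> chain Y g P s -> inside y (last P s) ->
  inside y P && all (inside y) s.
Proof.
elim: s P => [|V s IH] P oP /=; first by rewrite andbT.
move=> [[[h1 h2] _ _ _] oV cV] hl; have /andP[iV ->] := IH V oV cV hl.
rewrite andbT iV andbT; case: oV => _ [a1 a2 a3] _ _ _; move: iV; rewrite /inside; order_lia.
Qed.

(** [nm V + cur Y V = 2 * nm V + nk V <= cur Y P], so the sum telescopes. *)
Lemma chain_nm Y g P s : node_ok Y g P -> chain Y g P s -> \sum_(V <- s) nm V <= cur Y P.
Proof.
elim: s P => [|V s IH] P oP /=.
  by move=> _; rewrite big_nil; have := nm_gt0 oP; case: oP => _ _ [_ ->] _ _ => h; apply: addr_ge0 => //; lra.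
move=> [[_ hM _ _] oV cV]; rewrite big_cons; have := IH V oV cV.
by case: oV => _ _ [_ ->] _ _; move: hM; lra.
Qed.

Lemma mass_outside Y (x z y : 'I_r) : y \notin Y -> (y <= x)%N || (z < y)%N ->
  mass (y |: Y) x z = mass Y x z.
Proof.
move=> yNY h; rewrite mass_insert // (_ : (_ < _ <= _)%N = false) ?addr0 //.
by apply/negbTE/negP => h'; case/orP: h; move: h'; order_lia.
Qed.

(** * Effect of one insertion on the chain *)

Section Step.
Variables (Y : {set 'I_r}) (y : 'I_r) (g g' : 'I_r -> nat) (J : {set 'I_r}).
Hypotheses (sgY : short_gaps Y) (yNY : y \notin Y).
Hypotheses (mv : lazy_move m Y y g g' J).

Lemma node_update V l t : node_ok Y g V -> inside y V ->
  l \in Y -> t \in Y -> (nx V < l <= nl V)%N -> (nr V <= t < nz V)%N ->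
  (forall v, v \in Y -> (nx V <= v <= l)%N -> v \notin J) ->
  (forall v, v \in Y -> (t <= v <= nz V)%N -> v \notin J) ->
  nm V / 16 <= mass Y (nx V) l -> nm V / 16 <= mass Y t (nz V) ->
  node_ok (y |: Y) g' (Node (nx V) l t (nz V) (nm V) (nk V).+1).
Proof.
move=> oV /andP[ly yr] lY tY /andP[xl ll] /andP[rt tz] hl ht ml mt.
have xz := node_lt oV.
case: oV => -[xY lYo rY zY] [h1 h2 h3] [hT e] [m1 m2] [g1 g2].
have Y'Y v : v \in Y -> v \in y |: Y by move=> h; rewrite inE h orbT.
have gE v : v \in Y -> v \notin J -> g' v = g v by case: mv => _ _ _ _; apply.
have gx : g' (nx V) = g (nx V) by apply: gE => //; apply: hl => //; rewrite leqnn ltnW.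
have gz : g' (nz V) = g (nz V) by apply: gE => //; apply: ht => //; rewrite leqnn ltnW.
have mL (v : 'I_r) : (v <= nl V)%N -> mass (y |: Y) (nx V) v = mass Y (nx V) v.
  move=> vl; rewrite mass_insert // (_ : (_ < _ <= _)%N = false) ?addr0 //.
  by apply/negbTE; order_lia.
have mR (v : 'I_r) : (nr V <= v)%N -> mass (y |: Y) v (nz V) = mass Y v (nz V).
  move=> vr; rewrite mass_insert // (_ : (_ < _ <= _)%N = false) ?addr0 //.
  by apply/negbTE; order_lia.
have eL : nlen g' (Node (nx V) l t (nz V) (nm V) (nk V).+1) = nlen g V by rewrite /nlen /len /= gx gz.
split=> //=.
- by split; exact: Y'Y.
- by split=> //; order_lia.
- split=> //; move: e; rewrite /cur /= mass_insert // (_ : (_ < _ <= _)%N = true) => [->|].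
    by rewrite -natr1 addrA.
  by order_lia.
- rewrite mL // mR //; split.
    rewrite ml /=; apply: le_trans (_ : _ <= mass Y (nx V) (nl V)) _; last by case/andP: m1.
    have hh : (nx V <= l <= nl V)%N by order_lia.
    by rewrite (massD lam Y hh) lerDl mass_ge0.
  rewrite mt /=; apply: le_trans (_ : _ <= mass Y (nr V) (nz V)) _; last by case/andP: m2.
  have hh : (nr V <= t <= nz V)%N by order_lia.
  by rewrite (massD lam Y hh) lerDr mass_ge0.
- rewrite eL; split=> v; rewrite in_setU1 => /orP[/eqP-> /andP[hv1 hv2]|vY /andP[hv1 hv2]].
  + by move: hv2 ly ll; order_lia.
  + rewrite mL ?(leq_trans hv2) // => h; rewrite /len gx gE //; last by apply: hl => //; order_lia.
    by apply: g1 => //; order_lia.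
  + by move: hv1 yr rt; order_lia.
  + rewrite mR ?(leq_trans rt) // => h; rewrite /len gz gE //; last by apply: ht => //; order_lia.
    by apply: g2 => //; order_lia.
Qed.

Lemma creditS V : credit V + theta * (young V)%:R <=
  credit (Node (nx V) (nl V) (nr V) (nz V) (nm V) (nk V).+1).
Proof.
rewrite /credit /young /= -natr1 mulrDr mulr1.
case: (ltP (theta * (nk V)%:R) (nm V)) => h; rewrite ?mulr1 ?mulr0 ?addr0.
  rewrite le_min; apply/andP; split.
    by rewrite lerD2r ge_min lexx.
  by rewrite lerD2r ge_min (ltW h).
rewrite le_min !ge_min; apply/andP; split; last by rewrite lexx orbT.
by rewrite lerDl (le_trans ler01 theta_ge1).
Qed.

Lemma credit_le V : T <= nm V -> credit V + theta * (young V)%:R <= 2 * nm V.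
Proof.
move=> TV; rewrite /credit /young.
case: (ltP (theta * (nk V)%:R) (nm V)) => h; rewrite ?mulr1 ?mulr0 ?addr0.
  have : Num.min (theta * (nk V)%:R) (nm V + theta) <= theta * (nk V)%:R by rewrite ge_min lexx.
  by move: h theta_T; lra.
have : Num.min (theta * (nk V)%:R) (nm V + theta) <= nm V + theta by rewrite ge_min lexx orbT.
by move: theta_T; lra.
Qed.

(** Losing [nm V / 16] yields [4 * nm V] after scaling by 64, enough for the credit, at most
    [2 * nm V], and the error [128 * Q <= 2 * nm V]. *)
Lemma death_paid V (cost : R) : node_ok Y g V ->
  nm V / 16 <= worn Y V + cost ->
  pot Y V + theta * (young V)%:R <= 64 * cost.
Proof.
move=> oV; case: oV => _ _ [TV _] _ _; have := credit_le TV; rewrite /pot.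
by move: QT TV; lra.
Qed.

(** The block joins [y] in the core to a key outside [V] and so covers a whole margin; what that
    margin had lost earlier is in [worn]. *)
Lemma swallowed V j : node_ok Y g V -> inside y V -> j \in J ->
  (j <= nx V)%N || (nz V <= j)%N ->
  pot Y V + theta * (young V)%:R <=
    64 * (Q * (#|block_l J (nx V) (nl V)| + #|block_r J (nr V) (nz V)|)%:R).
Proof.
move=> oV /andP[ly yr] jJ hj; apply: death_paid => //.
have [-[xY lY rY zY] [h1 h2 h3] [TV _] [m1 m2] _] := oV.
have L0 : 0 <= Q * #|block_l J (nx V) (nl V)|%:R by rewrite mulr_ge0 // ltW.
have R0 : 0 <= Q * #|block_r J (nr V) (nz V)|%:R by rewrite mulr_ge0 // ltW.
have M0 := nm_gt0 oV.
rewrite natrD mulrDr /worn; case/orP: hj => hj.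
  have := swallow_l lam_ge0 Q_gt0 sgY mv xY lY (ltnW h1) ly jJ hj.
  by move: m1 m2 L0 R0 M0; lra.
have := swallow_r lam_ge0 Q_gt0 sgY mv rY zY (ltnW h3) yr jJ hj.
by move: m1 m2 L0 R0 M0; lra.
Qed.

(** A block that leaves the core of [P] swallows a margin of every node below; these margins are
    disjoint, so the payments add up within one block. *)
Lemma chain_killed j P s : chain Y g P s -> node_ok Y g P ->
  all (inside y) s -> j \in J -> (j <= nl P)%N || (nr P <= j)%N ->
  pots Y s + theta * (count young s)%:R <= 64 * (Q * #|block J (nl P) (nr P)|%:R).
Proof.
elim: s P => [|V s IH] P /=.
  by move=> *; rewrite /pots big_nil mulr0 add0r !mulr_ge0 // ltW.
move=> [[[lx zr] _ _ _] oV cV] oP /andP[iV iS] jJ hj.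
have hj' : (j <= nx V)%N || (nz V <= j)%N.
  by case/orP: hj => hj; apply/orP; [left|right]; order_lia.
have sw := swallowed oV iV jJ hj'.
have [_ [h1 h2 h3] _ _ _] := oV.
have hj'' : (j <= nl V)%N || (nr V <= j)%N.
  by case/orP: hj' => hj'; apply/orP; [left|right]; order_lia.
have := IH V cV oV iS jJ hj''; rewrite /pots big_cons natrD.
have := block_split J lx h1 h2 h3 zr; rewrite -(ler_nat R) [in X in X -> _]natrD.
set B1 := (_ + _)%:R in sw *; set B2 := _%:R; set B3 := _%:R.
move=> hB; have : Q * (B1 + B2) <= Q * B3 by rewrite ler_pM2l.
by move: sw; lra.
Qed.

Lemma link_update P P' V V' : link Y g P V -> node_ok Y g P -> node_ok Y g V ->
  [/\ nx P' = nx P, nl P' = nl P, nr P' = nr P & nz P' = nz P] ->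
  [/\ nx V' = nx V, nz V' = nz V, nm V' = nm V & nk V' = (nk V).+1] ->
  inside y P -> inside y V -> nlen g' P = nlen g P -> nlen g' V = nlen g V ->
  link (y |: Y) g' P' V'.
Proof.
move=> [[h1 h2] hM hD hF] oP oV [ex el er ez] [vx vz vm vk] iP iV eP eV.
have cE : cur (y |: Y) P' - (nk V')%:R = cur Y P - (nk V)%:R.
  rewrite /cur ex ez mass_insert // vk -natr1 (_ : (_ < _ <= _)%N = true) /=; first by ring.
  by case: oP => _ [a1 a2 a3] _ _ _; move: iP; rewrite /inside; order_lia.
have lP : nlen g' P' = nlen g P by rewrite -eP /nlen ex ez.
have lV : nlen g' V' = nlen g V by rewrite -eV /nlen vx vz.
by split; rewrite ?vx ?vz ?el ?er ?cE ?lP ?lV ?vm.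
Qed.

(** Nodes whose core contains the block merely age. At the first other node [V] everything deeper is
    swallowed, [V] itself shrinks its margins or dies, and fresh nodes restore the length of the
    chain. *)
Lemma chain_step i P P' s : short_gaps (y |: Y) ->
  chain Y g P s -> node_ok Y g P -> node_ok (y |: Y) g' P' ->
  [/\ nx P' = nx P, nl P' = nl P, nr P' = nr P & nz P' = nz P] ->
  good (y |: Y) g' i P' -> (i + size s <= d)%N -> inside y P -> all (inside y) s ->
  (forall v, v \in J -> (nl P < v < nr P)%N) ->
  exists s', [/\ size s' = size s, chain (y |: Y) g' P' s'
    & pots Y s + theta * (count young s)%:R <= pots (y |: Y) s' + 64 * (Q * #|J|%:R)].
Proof.
move=> sg'; have pY' : placed m (y |: Y) g' by case: mv.
have gE v : v \in Y -> v \notin J -> g' v = g v by case: mv => _ _ _ _; apply.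
elim: s i P P' => [|V s IH] i P P' /=.
  move=> *; exists [::]; split=> //; rewrite /pots !big_nil mulr0 !add0r !mulr_ge0 //; exact: ltW.
move=> [lV oV cV] oP oP' eP gP' hd iP /andP[iV iS] JP.
have [-[xY lY rY zY] [h1 h2 h3] [TV eV] [m1 m2] _] := oV.
have [-[xYP _ _ zYP] [p1 p2 p3] _ _ _] := oP.
have [[lx zr] _ _ _] := lV.
have JN (v : 'I_r) : (v <= nl P)%N || (nr P <= v)%N -> v \notin J.
  by move=> hv; apply/negP => /JP; move: hv; order_lia.
have eLP : nlen g' P = nlen g P.
  by rewrite /nlen /len !gE //; apply: JN; rewrite ?(ltnW p1) ?(ltnW p3) ?orbT.
have hd' : (i.+1 + size s <= d)%N by rewrite addSnnS.
have [hJ|] := boolP [forall v in J, nl V < v < nr V]%N.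
  move/forall_inP in hJ.
  have JV (v : 'I_r) : (v <= nl V)%N || (nr V <= v)%N -> v \notin J.
    by move=> hv; apply/negP => /hJ; move: hv; order_lia.
  pose V' := Node (nx V) (nl V) (nr V) (nz V) (nm V) (nk V).+1.
  have oV' : node_ok (y |: Y) g' V'.
    apply: node_update => //; rewrite ?h1 ?h3 ?leqnn //.
    - by move=> v _ hv; apply: JV; order_lia.
    - by move=> v _ hv; apply: JV; order_lia.
    - by case/andP: m1.
    - by case/andP: m2.
  have eLV : nlen g' V = nlen g V.
    by rewrite /nlen /len !gE //; apply: JV; rewrite ?(ltnW h1) ?(ltnW h3) ?orbT.
  have lV' : link (y |: Y) g' P' V' by apply: (link_update lV).
  have gV' := link_good pY' oP' oV' lV' gP'.
  have [//|s' [ss' cs' ps']] := IH i.+1 V V' cV oV oV' _ gV' hd' iV iS hJ.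
  exists (V' :: s'); split=> //=; first by rewrite ss'.
  rewrite /pots !big_cons natrD; have := creditS V; rewrite -/V'.
  have eW : worn (y |: Y) V' = worn Y V.
    have /andP[ly yr] := iV.
    by rewrite /worn /V' /= !mass_outside ?ly ?orbT // (ltnW yr).
  rewrite /pot eW; move: ps'; rewrite /pots; lra.
rewrite negb_forall_in => /exists_inP[j jJ hj].
have {}hj : (j <= nl V)%N || (nr V <= j)%N by move: hj; order_lia.
have kill := chain_killed cV oV iS jJ hj.
have /andP[ly yr] := iV.
have [l [l'Y hl ml hlJ]] := margin_l lam_ge0 Q_gt0 sgY mv xY lY (ltnW h1) ly.
have [t [t'Y ht mt htJ]] := margin_r lam_ge0 Q_gt0 sgY mv rY zY (ltnW h3) yr.
have BJ : Q * (#|block_l J (nx V) (nl V)|%:R + #|block_r J (nr V) (nz V)|%:R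
             + #|block J (nl V) (nr V)|%:R) <= Q * #|J|%:R.
  rewrite ler_pM2l // -!natrD ler_nat; apply: leq_trans (block_split J lx h1 h2 h3 zr) _.
  by apply/subset_leq_card/subsetP => v; rewrite inE => /andP[].
have eML : mass Y (nx V) (nl V) = mass Y (nx V) l + mass Y l (nl V) by apply: massD.
have eMR : mass Y (nr V) (nz V) = mass Y (nr V) t + mass Y t (nz V) by apply: massD.
have [xl' ll'] := andP hl; have [rt' tz'] := andP ht.
have g0l := mass_ge0 lam_ge0 Y xl'; have g0t := mass_ge0 lam_ge0 Y tz'.
have M0 := nm_gt0 oV.
(* [V] survives if both margins keep half of the nominal [nm V / 8]; the loss is then recorded in
   [worn], and otherwise it pays for the death of [V]. *)
have [/andP[al at']|dead] := boolP ((nm V / 16 <= mass Y (nx V) l) && (nm V / 16 <= mass Y t (nz V))).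
  pose V' := Node (nx V) l t (nz V) (nm V) (nk V).+1.
  have xl : (nx V < l)%N.
    rewrite ltn_neqAle xl' andbT; apply/eqP => /ord_inj e.
    by move: al M0; rewrite -e massxx; lra.
  have tz : (t < nz V)%N.
    rewrite ltn_neqAle tz' andbT; apply/eqP => /ord_inj e.
    by move: at' M0; rewrite e massxx; lra.
  have oV' : node_ok (y |: Y) g' V'.
    by apply: node_update => //; [rewrite xl ll' | rewrite rt' tz | exact: hlJ | exact: htJ].
  have eLV : nlen g' V = nlen g V.
    have xJ : nx V \notin J by apply: (hlJ xl); rewrite ?leqnn ?xl'.
    have zJ : nz V \notin J by apply: (htJ tz); rewrite ?leqnn ?tz'.
    by rewrite /nlen /len !gE.
  have lV' : link (y |: Y) g' P' V' by apply: (link_update lV).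
  have gV' := link_good pY' oP' oV' lV' gP'.
  have [s' [ss' cs' ps']] := chain_extend pY' sg' hd' oV' gV'.
  exists (V' :: s'); split=> //=; first by rewrite ss'.
  move: kill ps'; rewrite /pots !big_cons natrD; have := creditS V; rewrite /pot -/V'.
  have -> : credit V' = credit (Node (nx V) (nl V) (nr V) (nz V) (nm V) (nk V).+1) by [].
  have -> : worn (y |: Y) V' = (nm V / 8 - mass Y (nx V) l) + (nm V / 8 - mass Y t (nz V)).
    have lly := leq_ltn_trans ll' ly; have yrt := leq_trans (ltnW yr) rt'.
    by rewrite /worn /V' /= !mass_outside ?lly ?yrt ?orbT.
  move: BJ ml mt; rewrite /worn eML eMR; lra.
have [s' [ss' cs' ps']] := chain_extend pY' sg' hd oP' gP'.
exists s'; split=> //.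
have := @death_paid V (Q * (#|block_l J (nx V) (nl V)|%:R + #|block_r J (nr V) (nz V)|%:R)) oV.
have -> : nm V / 16 <= worn Y V + Q * (#|block_l J (nx V) (nl V)|%:R + #|block_r J (nr V) (nz V)|%:R).
  have g0l' := mass_ge0 lam_ge0 Y ll'; have g0t' := mass_ge0 lam_ge0 Y rt'.
  move: dead; rewrite negb_and -!ltNge /worn => /orP[] dead;
    by move: dead ml mt m1 m2 eML eMR g0l' g0t'; lra.
move=> /(_ isT); move: kill ps' BJ; rewrite /pots !big_cons natrD; lra.
Qed.

End Step.

(** With stored keys on both sides of [y], both new gaps are parts of one old gap. *)
Lemma short_gaps_insert Y (x y z : 'I_r) : short_gaps Y -> x \in Y -> z \in Y ->
  (x < y < z)%N -> y \notin Y -> short_gaps (y |: Y).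
Proof.
move=> sg xY zY /andP[xy yz] yNY a c aY cY ac nb.
have nb' v : v \in Y -> ~~ (a < v < c)%N by move=> vY; apply: nb; rewrite inE vY orbT.
move: aY; rewrite in_setU1 => /orP[/eqP ea|aY]; last first.
  move: cY; rewrite in_setU1 => /orP[/eqP ec|cY]; last exact: sg.
  subst c; pose Pr v := (v \in Y) && (y < v)%N.
  have Pz : Pr z by rewrite /Pr zY yz.
  case: (@arg_minnP _ z Pr (fun v : 'I_r => v : nat) Pz) => w /andP[wY yw] H.
  have : lam * ((w : nat)%:R - (a : nat)%:R) + 1 <= Q.
    apply: sg => //; first by order_lia.
    move=> v vY; apply/negP => hv; have [yv|vy] := ltnP y v.
      have := H v; rewrite /Pr vY yv => /(_ isT) /=; move: hv; order_lia.
    have vNy : (v : nat) <> y by move=> e; move/negP: yNY; apply; rewrite -(ord_inj e).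
    have := nb' v vY; move: hv vy vNy; order_lia.
  apply: le_trans; rewrite lerD2r ler_wpM2l // lerD2r ler_nat; exact: ltnW.
subst a; move: cY; rewrite in_setU1 => /orP[/eqP ec|cY].
  by move: ac; rewrite ec ltnn.
pose Pr v := (v \in Y) && (v < y)%N.
have Px : Pr x by rewrite /Pr xY xy.
case: (@arg_maxnP _ x Pr (fun v : 'I_r => v : nat) Px) => w /andP[wY yw] H.
have : lam * ((c : nat)%:R - (w : nat)%:R) + 1 <= Q.
  apply: sg => //; first by order_lia.
  move=> v vY; apply/negP => hv; have [yv|vy] := ltnP v y.
    have := H v; rewrite /Pr vY yv => /(_ isT) /=; move: hv; order_lia.
  have vNy : (v : nat) <> y by move=> e; move/negP: yNY; apply; rewrite -(ord_inj e).
  have := nb' v vY; move: hv vy vNy; order_lia.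
apply: le_trans; rewrite lerD2r ler_wpM2l // lerD2l lerN2 ler_nat; exact: ltnW.
Qed.

(** * The strategy and its accounting *)

Variables (n : nat) (p q : 'I_r) (h : nat) (avail : nat -> {set 'I_r} -> Prop).
Hypothesis pq : (p < q)%N.
Hypothesis few_old : forall k, D0 * (1 + 1 / (3 * theta)) ^+ k <= b ^+ d * Q -> (k + h <= d)%N.
Hypothesis pick : forall t Y (x z : 'I_r), (t < n)%N -> avail t Y ->
  x \in Y -> z \in Y -> (x < z)%N ->
  D0 * (keys Y x z)%:R <= b ^+ d.+1 * mass Y x z ->
  exists y : 'I_r, [/\ y \notin Y, (x < y < z)%N & avail t.+1 (y |: Y)].
Hypotheses (D0_ge0 : 0 <= D0) (m_gt0 : (0 < m)%N) (F0E : F0 = D0 * m%:R * D0 ^+ N).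

Definition ready Y := [/\ p \in Y, q \in Y, short_gaps Y & D0 * m%:R <= mass Y p q].

(** The interval from [p] to [q] spans at most [m] cells, hence has density at least [D0] and
    fatness at least [F0]; the root is the fattest interval inside it. *)
Lemma fresh_chain Y g : placed m Y g -> ready Y ->
  exists P s, [/\ node_ok Y g P, good Y g 0 P, chain Y g P s, size s = d & 0 <= pots Y s].
Proof.
move=> pY [pYk qYk sg hM].
have L0 := len_gt0 R pY pYk qYk pq.
have Lm : len g p q <= m%:R.
  by case: pY => _ gb; rewrite /len lerBlDr -natrD ler_nat ltnW // ltn_addr // gb.
have hD : D0 <= mass Y p q / len g p q.
  rewrite ler_pdivlMr //; apply: le_trans hM; exact: ler_wpM2l.
have hF : F0 <= fat Y g p q.
  rewrite F0E /fat; apply: ler_pM => //.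
  - exact: mulr_ge0.
  - exact: exprn_ge0.
  - by rewrite lerXn2r ?nnegrE // (le_trans D0_ge0).
have [x z xY zY xz hf|P [oP [pP Pq] kP fP wP]] := fat_select pY sg pYk qYk pq.
  by apply: (@mass_large Y g 0) => //; rewrite mul1r; apply: le_trans hf.
have [-[xY _ _ zY] _ _ _ _] := oP; have xz := node_lt oP.
have gP : good Y g 0 P.
  split; rewrite expr0 mul1r; last exact: le_trans fP.
  apply: le_trans hD _.
  exact: (dens_le_of_fat pY xY zY pYk qYk pP xz Pq fP).
have [s [ss cs ps]] := chain_extend pY sg (leqnn (0 + d)) oP gP.
by exists P, s.
Qed.

(** A charge of [theta * h] per step since [n0] is covered by relocations and by the potential of
    the chain; the root [P] carries none. *)
Definition playing n0 t Y g c := [/\ ready Y, avail t Y, (n0 <= t)%N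
  & exists P s, [/\ node_ok Y g P, good Y g 0 P, chain Y g P s, size s = d
    & (t - n0)%:R * (theta * h%:R) <= 64 * (Q * c%:R) + pots Y s]].

Lemma playing_start n0 Y g c : placed m Y g -> ready Y -> avail n0 Y -> playing n0 n0 Y g c.
Proof.
move=> pY rY aY; split=> //; have [P [s [oP gP cs ss ps]]] := fresh_chain pY rY.
exists P, s; split=> //; rewrite subnn mul0r addr_ge0 // !mulr_ge0 //; exact: ltW.
Qed.

(** A key put into the core of the last node lies in all cores and ages every node; at least [h] of
    them are young and gain [theta] each. *)
Lemma playing_step n0 t Y g c : (t < n)%N -> placed m Y g -> playing n0 t Y g c ->
  exists2 y, y \notin Y & forall g' J, lazy_move m Y y g g' J ->
    playing n0 t.+1 (y |: Y) g' (c + #|J|).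
Proof.
move=> tn pY [rY aY n0t [P [s [oP gP cs ss hpot]]]].
have [pYk qYk sg hM] := rY; have b0 : 0 <= b by apply: le_trans b_ge1.
have [oL gL] := chain_good pY oP cs gP.
set L := last P s in oL gL; rewrite add0n ss in gL.
have [-[xL lL rL zL] [l1 l2 l3] [TL _] _ _] := oL.
have Q0 := ltW Q_gt0.
(* The last core still has density at least [D0 / b ^+ d.+1] and no fewer cells than keys, which is
   the premise of [pick]. *)
have [y [yNY hy avy]] : exists y : 'I_r, [/\ y \notin Y, (nl L < y < nr L)%N & avail t.+1 (y |: Y)].
  apply: pick => //; have [hD _] := gL.
  have len0 := len_gt0 R pY lL rL l2; have n0' := nlen_gt0 pY oL.
  apply: le_trans (_ : _ <= D0 * len g (nl L) (nr L)) _.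
    by rewrite ler_wpM2l // (keys_le_len lam_ge0 Q0 pY) // ltnW.
  apply: le_trans (ler_wpM2r (ltW len0) hD) _.
  rewrite exprSr -!mulrA ler_wpM2l ?exprn_ge0 //.
  by rewrite mulrA mulrAC ler_pdivrMr //; apply: core_density pY oL.
have iL : inside y L by [].
have /andP[iP iS] := chain_inside oP cs iL.
exists y => // g' J mv; have pY' : placed m (y |: Y) g' by case: mv.
have [-[xP lP rP zP] [p1 p2 p3] [TP eP] [m1 m2] _] := oP.
have sg' : short_gaps (y |: Y) by apply: (short_gaps_insert sg lP rP).
have rY' : ready (y |: Y).
  split=> //; try by rewrite in_setU1 ?pYk ?qYk orbT.
  by rewrite mass_insert //; apply: le_trans hM _; rewrite lerDl.
have yng : (h <= count young s)%N.
  have ho := chain_old pY oP cs; rewrite ss -/L in ho.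
  have : D0 * (1 + 1 / (3 * theta)) ^+ count (predC young) s <= b ^+ d * Q.
    have [hD _] := gP; rewrite expr0 mul1r in hD.
    apply: le_trans (_ : _ <= cur Y P / nlen g P * (1 + 1 / (3 * theta)) ^+ count (predC young) s) _.
      by rewrite ler_wpM2r // exprn_ge0 // addr_ge0 // divr_ge0 //; move: theta_ge1; lra.
    apply: le_trans ho _; rewrite ler_wpM2l ?exprn_ge0 //.
    rewrite ler_pdivrMr ?(nlen_gt0 pY oL) //.
    apply: le_trans (mass_le_keys lam_ge0 Q0 sg xL zL (ltnW (node_lt oL))) _.
    by rewrite ler_pM2l // (keys_le_len lam_ge0 Q0 pY) // ltnW // (node_lt oL).
  move/few_old; have := count_predC young s; rewrite ss; order_lia.
have tE : (t.+1 - n0)%:R * (theta * h%:R) <= (t - n0)%:R * (theta * h%:R) + theta * (count young s)%:R.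
  rewrite subSn // -natr1 mulrDl mul1r lerD2l ler_wpM2l ?ler_nat //.
  by move: theta_ge1; lra.
split=> //; first exact: leqW.
have [hJ|] := boolP [forall v in J, nl P < v < nr P]%N.
  move/forall_inP in hJ.
  have JV (v : 'I_r) : (v <= nl P)%N || (nr P <= v)%N -> v \notin J.
    by move=> hv; apply/negP => /hJ; move: hv; order_lia.
  have gE v : v \in Y -> v \notin J -> g' v = g v by case: mv => _ _ _ _; apply.
  pose P' := Node (nx P) (nl P) (nr P) (nz P) (nm P) (nk P).+1.
  have oP' : node_ok (y |: Y) g' P'.
    apply: (node_update yNY mv) => //; rewrite ?p1 ?p3 ?leqnn //.
    - by move=> v _ hv; apply: JV; order_lia.
    - by move=> v _ hv; apply: JV; order_lia.
    - by case/andP: m1.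
    - by case/andP: m2.
  have eL : nlen g' P' = nlen g P.
    by rewrite /nlen /len /= !gE //; apply: JV; rewrite ?(ltnW p1) ?(ltnW p3) ?orbT.
  have nP := nlen_gt0 pY oP; have M0 := nm_gt0 oP.
  have cP : cur Y P <= cur (y |: Y) P' by rewrite /cur /= mass_insert // lerDl.
  have c0 : 0 <= cur Y P by rewrite eP; apply: addr_ge0 => //; lra.
  have dP : cur Y P / nlen g P <= cur (y |: Y) P' / nlen g' P'.
    by rewrite eL ler_pdivrMr // divfK // gt_eqF.
  have gP' : good (y |: Y) g' 0 P'.
    case: gP => h1 h2; rewrite !expr0 !mul1r in h1 h2; split; rewrite expr0 mul1r.
      exact: le_trans dP.
    apply: le_trans h2 _; rewrite /fat -/(cur Y P) -/(nlen g P).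
    rewrite -/(cur (y |: Y) P') -/(nlen g' P'); apply: ler_pM => //.
      by apply: exprn_ge0; apply: divr_ge0 => //; exact: ltW.
    have dp0 : 0 <= cur Y P / nlen g P by apply: divr_ge0 => //; exact: ltW.
    by rewrite lerXn2r ?nnegrE // (le_trans dp0).
  have [||s' [ss' cs' ps']] := chain_step sg yNY mv sg' cs oP oP' _ gP' _ iP iS hJ => //.
    by rewrite ss.
  exists P', s'; split=> //; first by rewrite ss'.
  by apply: le_trans tE _; rewrite natrD; move: hpot ps'; lra.
rewrite negb_forall_in => /exists_inP[j jJ hj].
have {}hj : (j <= nl P)%N || (nr P <= j)%N by move: hj; order_lia.
(* The block leaves the core of the root: the whole chain is swallowed and paid for, and a new one
   is built. *)
have kill := chain_killed sg mv cs oP iS jJ hj.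
have [P' [s' [oP' gP' cs' ss' ps']]] := fresh_chain pY' rY'.
exists P', s'; split=> //; apply: le_trans tE _; rewrite natrD.
have : Q * #|block J (nl P) (nr P)|%:R <= Q * #|J|%:R.
  rewrite ler_pM2l // ler_nat; apply/subset_leq_card/subsetP => v.
  by rewrite inE => /andP[].
by move: hpot kill ps'; lra.
Qed.

(** The potential left at the end is at most [4 * nm V] per node, and the masses [nm V] sum to at
    most the mass of the root. *)
Lemma playing_bound n0 t Y g c : placed m Y g -> playing n0 t Y g c ->
  (t - n0)%:R * (theta * h%:R) <= 64 * (Q * c%:R) + 4 * (Q * #|Y|%:R).
Proof.
move=> pY [[_ _ sg _] aY n0t [P [s [oP gP cs ss hpot]]]].
have [-[xP lP rP zP] [p1 p2 p3] [TP eP] [m1 m2] _] := oP.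
apply: le_trans hpot _; rewrite lerD2l.
have pot4 V : node_ok Y g V -> pot Y V <= 4 * nm V.
  case=> _ _ [TV _] [/andP[_ w1] /andP[_ w2]] _.
  rewrite /pot /credit /worn.
  have : Num.min (theta * (nk V)%:R) (nm V + theta) <= nm V + theta by rewrite ge_min lexx orbT.
  by move: theta_T QT w1 w2 TV; lra.
have : pots Y s <= 4 * \sum_(V <- s) nm V.
  rewrite /pots mulr_sumr; elim: s P cs {oP gP ss xP lP rP zP p1 p2 p3 TP eP m1 m2} => [|V s IH] P /=.
    by rewrite !big_nil.
  by move=> [_ oV cV]; rewrite !big_cons lerD ?pot4 //; apply: IH cV.
move=> hp; apply: le_trans hp _; rewrite ler_wpM2l //.
apply: le_trans (chain_nm oP cs) _.
apply: le_trans (mass_le_keys lam_ge0 (ltW Q_gt0) sg xP zP (ltnW (node_lt oP))) _.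
rewrite ler_pM2l // ler_nat; apply/subset_leq_card/subsetP => v.
by rewrite inE => /andP[].
Qed.

End Chains.

(** * Numerical estimates *)

Lemma cost_ge n m r (A : algorithm n m r) (s : n.-tuple 'I_r) :
  uniq s -> (n <= cost A s)%N.
Proof.
move=> us; rewrite -[X in (X <= _)%N](card_ord n) -[X in (X <= _)%N]muln1 -sum_nat_const.
apply: leq_sum => t _; rewrite card_gt0; apply/set0Pn; exists (tnth s t).
have ts : tnth s t \in take t.+1 s.
  by rewrite (take_nth (tnth s t)) ?size_tuple // mem_rcons inE -tnth_nth eqxx.
by rewrite inE; apply/andP; split; [exact: ts | rewrite eqxx].
Qed.

(** The trivial bound, for the ranges in which the claimed bound is at most [n]. *)
Lemma chi_ge n m r : (0 < n)%N -> (n <= m)%N -> (n <= r)%N -> (n <= chi n m r)%N.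
Proof.
move=> n0 nm nr; have [A lA <-] := chi_attained r n0 nm.
have us : uniq [tuple widen_ord nr i | i < n].
  rewrite map_inj_uniq ?enum_uniq // => i j /(congr1 val) /= h; exact: ord_inj.
exact: leq_trans (cost_ge A us) (leq_bigmax_cond _ us).
Qed.

(** * The evenly spaced initial keys *)

Section Multiples.
Variables (R : realType) (r G : nat) (lam Q : R).

(* The keys inserted before the actual game begins. *)
Definition multiples k : {set 'I_r} := [set x : 'I_r | (G %| x)%N && (x < k * G)%N].

Hypothesis G_gt0 : (0 < G)%N.

Lemma multiples0 : multiples 0 = set0.
Proof. by apply/setP => x; rewrite !inE mul0n andbF. Qed.

Lemma multiplesS k (y : 'I_r) : y = (k * G)%N :> nat ->
  y \notin multiples k /\ y |: multiples k = multiples k.+1.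
Proof.
move=> ey; split; first by rewrite inE ey ltnn andbF.
apply/setP => x; rewrite !inE; apply/idP/idP.
  case/orP => [/eqP ->|/andP[-> h]].
    by rewrite ey dvdn_mull //= mulSn -[X in (X < _)%N]add0n ltn_add2r.
  by rewrite /= mulSn (leq_trans h) // leq_addl.
move=> /andP[/dvdnP[i ei] hx]; move: hx; rewrite ei ltn_mul2r G_gt0 /= ltnS leq_eqVlt.
case/orP => [/eqP ik|ik]; last by rewrite dvdn_mull // ltn_mul2r G_gt0 ik orbT.
by rewrite (_ : x == y) //; apply/eqP/ord_inj; rewrite ei ey ik.
Qed.

Lemma multiples_gap k (x z : 'I_r) : x \in multiples k -> z \in multiples k ->
  (x < z)%N -> (x + G <= z)%N.
Proof.
rewrite !inE => /andP[/dvdnP[i ->] _] /andP[/dvdnP[j ->] _].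
by rewrite ltn_mul2r => /andP[_ ij]; rewrite addnC -mulSn leq_mul2r ij orbT.
Qed.

Lemma multiples_short k : 0 <= lam -> lam * G%:R + 1 <= Q -> short_gaps lam Q (multiples k).
Proof.
move=> lam0 hQ x z xM zM xz nb; apply: le_trans hQ.
rewrite lerD2r ler_wpM2l // lerBlDr -natrD ler_nat.
have := multiples_gap xM zM xz; rewrite leq_eqVlt => /orP[/eqP<-|h].
  by rewrite addnC.
have ylt : (x + G < r)%N := ltn_trans h (ltn_ord z).
have yM : Ordinal ylt \in multiples k.
  move: xM zM; rewrite !inE /= => /andP[xG _] /andP[_ zk].
  by rewrite dvdn_addr // dvdnn (ltn_trans h zk).
by have := nb _ yM; rewrite /= h -[X in (X < _)%N]addn0 ltn_add2l G_gt0.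
Qed.

Lemma multiples_keys k (x z : 'I_r) : x = 0%N :> nat -> z = (k * G)%N :> nat ->
  (k <= keys (multiples k.+1) x z)%N.
Proof.
move=> ex ez; rewrite -[X in (X <= _)%N](card_ord k).
have lt (i : 'I_k) : (i.+1 * G < r)%N.
  by apply: leq_ltn_trans (ltn_ord z); rewrite ez leq_mul2r ltn_ord orbT.
have inj : injective (fun i : 'I_k => Ordinal (lt i)).
  move=> i j /(congr1 val) /= /eqP; rewrite eqn_mul2r (gtn_eqF G_gt0) /= => /eqP[h].
  exact: ord_inj.
rewrite -(card_imset _ inj); apply/subset_leq_card/subsetP => v /imsetP[i _ ->].
rewrite !inE /= dvdn_mull //= ex ez ltn_mul2r G_gt0 /= ltnS (ltn_ord i) muln_gt0 /= G_gt0.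
by rewrite leq_mul2r ltn_ord orbT.
Qed.

End Multiples.

Section Numbers.
Variable R : realType.
Implicit Types x : R.

Lemma expR_half_le2 : expR (1 / 2) <= 2 :> R.
Proof.
have h : 1 / 2 <= expR (- (1 / 2)) :> R by apply: le_trans (expR_ge1Dx _); lra.
rewrite -[expR _]invrK -expRN -[X in _ <= X]invrK lef_pV2 ?posrE ?expR_gt0 ?invr_gt0 //.
by move: h; lra.
Qed.

Lemma expR1_le4 : expR 1 <= 4 :> R.
Proof.
have e := expR_half_le2.
have -> : expR 1 = expR (1 / 2) * expR (1 / 2) :> R by rewrite -expRD; congr expR; lra.
by have := ler_pM (expR_ge0 _) (expR_ge0 _) e e; lra.
Qed.

Lemma expR2_le16 : expR 2 <= 16 :> R.
Proof.
have -> : expR 2 = expR 1 * expR 1 :> R by rewrite -expRD; congr expR; lra.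
by have := ler_pM (expR_ge0 _) (expR_ge0 _) expR1_le4 expR1_le4; lra.
Qed.

Lemma expR4_ge16 : 16 <= expR 4 :> R.
Proof.
have h : 2 <= expR 1 :> R by apply: le_trans (expR_ge1Dx _); lra.
have h2 : 4 <= expR 2 :> R.
  have -> : expR 2 = expR 1 * expR 1 :> R by rewrite -expRD; congr expR; lra.
  by have := ler_pM (ler0n R _) (ler0n R _) h h; lra.
have -> : expR 4 = expR 2 * expR 2 :> R by rewrite -expRD; congr expR; lra.
by have := ler_pM (ler0n R _) (ler0n R _) h2 h2; lra.
Qed.

(** This is [1 + u <= expR u] at [u = - x / (1 + x)], inverted. *)
Lemma expR_le1D x : 0 <= x -> expR (x / (1 + x)) <= 1 + x.
Proof.
move=> x0; have x1 : 0 < 1 + x by lra.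
have h : (1 + x)^-1 <= expR (- (x / (1 + x))).
  apply: le_trans (expR_ge1Dx _); rewrite le_eqVlt; apply/orP; left; apply/eqP.
  by field; rewrite gt_eqF.
by rewrite -[expR _]invrK -expRN -[X in _ <= X]invrK lef_pV2 ?posrE ?expR_gt0 ?invr_gt0.
Qed.

End Numbers.

(** Fixes the parameters of the chain: [2 * h] levels, of which at least [h] stay young. [La] bounds
    the logarithm of [expR 1 * Q / D0], the range available to densities. *)
Lemma game_bound (R : realType) n m r n0 G h (A : algorithm n m r) (lam Q D0 La : R)
    (avail : nat -> {set 'I_r} -> Prop) :
  legal A -> (0 < m)%N -> 0 <= lam -> 0 < Q -> 0 < D0 -> 4 <= La ->
  expR 1 * Q <= D0 * expR La -> 4 * La <= h%:R ->
  (64 * Q + h%:R / (4 * La)) * expR (12 * (h%:R * La)) <= D0 * m%:R ->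
  (1 < n0 <= n)%N -> (0 < G)%N -> (n0.-1 * G < r)%N ->
  lam * G%:R + 1 <= Q -> D0 * m%:R <= lam * (n0.-1 * G)%:R + n0.-1%:R ->
  avail n0 (multiples r G n0) ->
  (forall t Y (x z : 'I_r), (t < n)%N -> avail t Y -> x \in Y -> z \in Y -> (x < z)%N ->
     D0 * (keys Y x z)%:R <= 16 * mass lam Y x z ->
     exists y : 'I_r, [/\ y \notin Y, (x < y < z)%N & avail t.+1 (y |: Y)]) ->
  exists2 s : n.-tuple 'I_r, uniq s &
    (n - n0)%:R * (h%:R ^+ 2 / (4 * La)) <= 68 * (Q * (cost A s)%:R).
Proof.
move=> lA m0 lam0 Q0 D00 La4 hQD hLa hbig /andP[n01 n0n] G0 Gr gapQ hM avl pick.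
have h0 : (0 < h)%N by rewrite -(ltr_nat R); lra.
have hR : 0 < h%:R :> R by rewrite ltr0n.
pose d := (2 * h)%N; pose N := (8 * h)%N; pose b : R := expR (1 / d%:R).
have d0 : 0 < d%:R :> R by rewrite ltr0n /d; order_lia.
pose theta := h%:R / (4 * La); pose T := 64 * Q + theta.
pose C := 4 * b ^+ N; pose F0 := D0 * m%:R * D0 ^+ N.
have N_gt0 : (0 < N)%N by rewrite /N; order_lia.
have b1 : 1 <= b by apply: le_trans (expR_ge1Dx _); rewrite lerDl divr_ge0 // ltW.
have bd : b ^+ d = expR 1 by rewrite /b -expRM_natr divfK // gt_eqF.
have bN : b ^+ N = expR 4.
  have -> : N = (d * 4)%N by rewrite /N /d; order_lia.
  by rewrite exprM bd -expRM_natr mul1r.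
have b_N : 16 <= b ^+ N by rewrite bN expR4_ge16.
have th1 : 1 <= theta by rewrite /theta ler_pdivlMr; lra.
have QT : 64 * Q <= T by rewrite /T; lra.
have thT : theta <= T by rewrite /T; lra.
(* [C <= expR 8] and [4 <= La] bound [C ^+ d] by [expR (4 * (h * La))]; the ratio of [Q ^+ N] to
   [D0 ^+ N] is at most [expR (8 * (h * La))]. Hence the 12 in the hypothesis. *)
have F0_ge : T * C ^+ d * Q ^+ N <= F0.
  have hC : C ^+ d <= expR (4 * (h%:R * La)).
    have C8 : C <= expR 8.
      have -> : expR 8 = expR 4 * expR 4 :> R by rewrite -expRD; congr expR; lra.
      rewrite /C bN ler_wpM2r ?expR_ge0 //.
      by apply: le_trans (expR4_ge16 R); lra.
    apply: le_trans (_ : expR 8 ^+ d <= _).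
      by rewrite lerXn2r ?nnegrE ?expR_ge0 // /C bN mulr_ge0 ?expR_ge0.
    rewrite -expRM_natr ler_expR /d natrM.
    have := ler_wpM2l (ltW hR) La4; lra.
  have hQ : Q ^+ N <= D0 ^+ N * expR (8 * (h%:R * La)).
    apply: le_trans (_ : (D0 * expR La) ^+ N <= _).
      rewrite lerXn2r ?nnegrE ?(ltW Q0) ?mulr_ge0 ?(ltW D00) ?expR_ge0 //.
      apply: le_trans hQD; rewrite ler_peMl ?(ltW Q0) //.
      by apply: le_trans (expR_ge1Dx _); lra.
    by rewrite exprMn -expRM_natr /N natrM (_ : La * _ = 8 * (h%:R * La)) //; ring.
  apply: le_trans (_ : T * expR (4 * (h%:R * La)) * (D0 ^+ N * expR (8 * (h%:R * La))) <= _).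
    apply: ler_pM; rewrite ?exprn_ge0 ?(ltW Q0) //.
      by apply: mulr_ge0; [lra | rewrite /C bN exprn_ge0 // mulr_ge0 ?expR_ge0].
    by apply: ler_wpM2l => //; lra.
  rewrite (_ : _ * _ = T * expR (12 * (h%:R * La)) * D0 ^+ N); last first.
    have -> : 12 * (h%:R * La) = 4 * (h%:R * La) + 8 * (h%:R * La) by ring.
    by rewrite expRD; ring.
  by rewrite /F0 ler_wpM2r // exprn_ge0 // ltW.
(* [k] old nodes force [k / (4 * theta) <= La], that is [k <= h], by the choice of [theta]. *)
have few k : D0 * (1 + 1 / (3 * theta)) ^+ k <= b ^+ d * Q -> (k + h <= d)%N.
  rewrite bd => hk.
  have : expR (k%:R / (4 * theta)) <= expR La.
    rewrite -(ler_pM2l D00); apply: le_trans hQD; apply: le_trans hk.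
    rewrite ler_pM2l // mulrC expRM_natr lerXn2r ?nnegrE ?expR_ge0 //.
      by apply: addr_ge0 => //; apply: divr_ge0; lra.
    have u0 : 0 <= 1 / (3 * theta) by apply: divr_ge0; lra.
    apply: le_trans (expR_le1D u0); rewrite ler_expR.
    have -> : 1 / (3 * theta) / (1 + 1 / (3 * theta)) = (3 * theta + 1)^-1.
      by field; apply/andP; split; rewrite gt_eqF //; lra.
    by rewrite lef_pV2 ?posrE; lra.
  rewrite ler_expR ler_pdivrMr; last lra.
  have -> : La * (4 * theta) = h%:R by rewrite /theta; field; rewrite gt_eqF //; lra.
  by rewrite ler_nat /d; order_lia.
have pick' t Y (x z : 'I_r) : (t < n)%N -> avail t Y -> x \in Y -> z \in Y -> (x < z)%N ->
     D0 * (keys Y x z)%:R <= b ^+ d.+1 * mass lam Y x z ->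
     exists y : 'I_r, [/\ y \notin Y, (x < y < z)%N & avail t.+1 (y |: Y)].
  move=> tn aY xY zY xz hk; apply: pick => //; apply: le_trans hk _.
  rewrite ler_wpM2r ?mass_ge0 ?(ltnW xz) //; apply: le_trans (expR2_le16 R).
  rewrite exprS bd -expRD ler_expR.
  have : 1 / d%:R <= 1 :> R by rewrite ler_pdivrMr // mul1r ler1n /d; order_lia.
  lra.
have r0 : (0 < r)%N by apply: leq_ltn_trans Gr.
pose p := Ordinal r0; pose q := Ordinal Gr.
have pq : (p < q)%N by rewrite /= muln_gt0 G0 andbT; order_lia.
have n0E : n0.-1.+1 = n0 by order_lia.
have rdy : ready m lam Q D0 p q (multiples r G n0).
  split.
  - by rewrite inE dvdn0 /= muln_gt0 G0 andbT; order_lia.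
  - by rewrite inE /= dvdn_mull //= ltn_mul2r G0 /=; order_lia.
  - exact: multiples_short.
  - apply: le_trans hM _; rewrite /mass /= subr0 lerD2l ler_nat.
    by rewrite -{2}n0E; apply: multiples_keys.
(* The first [n0] steps insert the multiples of [G] in order; the chain starts once they are all
   stored. *)
pose Inv t Y (g : 'I_r -> nat) c := ((t < n0)%N /\ Y = multiples r G t) \/
  playing m lam Q b C T N theta D0 F0 d p q h avail n0 t Y g c.
have [|t Y g c tn|s us [Y [g [c [hI pY cY hc]]]]] :=
    @lazy_adversary n m r A (fun=> 0%N) Inv lA.
- by left; rewrite multiples0; split=> //; order_lia.
- case=> [[tn0 ->] _|hp pY].
    have lt : (t * G < r)%N by apply: leq_ltn_trans (Gr); rewrite leq_mul2r; apply/orP; right; order_lia.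
    have [yN yE] := @multiplesS r G G0 t (Ordinal lt) (erefl _).
    exists (Ordinal lt) => // g' J [pY' _ _ _ _]; rewrite yE in pY' *.
    have [t1|t1] := ltnP t.+1 n0; [by left | right].
    have e : t.+1 = n0 by order_lia.
    rewrite e in pY' *.
    exact: (playing_start lam0 Q0 N_gt0 b1 b_N (erefl C) QT th1 F0_ge h pq (ltW D00) (erefl F0)).
  have [y yN hy] := playing_step lam0 Q0 N_gt0 b1 b_N (erefl C) QT th1 thT F0_ge pq few pick'
    (ltW D00) m0 (erefl F0) tn pY hp.
  by exists y => // g' J lz; right; apply: hy lz.
exists s => //.
case: hI => [[nn0 _]|hp]; first order_lia.
have := playing_bound lam0 Q0 QT thT pY hp.
rewrite cY; have nc : n%:R <= (cost A s)%:R :> R by rewrite ler_nat cost_ge.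
have {}hc : c%:R <= (cost A s)%:R :> R by rewrite ler_nat.
have := ler_wpM2l (ltW Q0) nc; have := ler_wpM2l (ltW Q0) hc.
have -> : h%:R ^+ 2 / (4 * La) = theta * h%:R by rewrite /theta; ring.
by lra.
Qed.

Lemma expR_ge_cube (R : realType) (x : R) : 0 <= x -> x ^+ 3 / 6 <= expR x.
Proof.
move=> x0; apply: le_trans (expR_ge1Dxn 2 x0).
by rewrite (_ : 3`!%:R = 6 :> R) // lerDr.
Qed.

(* [n = expR L] and [m / n = expR l]. *)
Lemma bound_from_depths (R : realType) (L l Q M0 X eta C1 n' : R) :
  10 ^+ 7 <= L -> 1 / 2 <= l -> expR L <= X -> 0 < Q -> Q <= 129 * expR l ->
  expR L / 4 <= M0 -> 0 <= eta -> eta * expR l <= 1 -> eta * Q * l <= 129 ->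
  10 ^+ 11 <= C1 -> expR L / 2 <= n' ->
  (forall h : nat, 4 * (8 * l) <= h%:R ->
     (64 * Q + h%:R / (4 * (8 * l))) * expR (12 * (h%:R * (8 * l))) <= M0 ->
     n' * (h%:R ^+ 2 / (4 * (8 * l))) <= 68 * (Q * X)) ->
  expR L * L ^+ 2 * (eta / (C1 * l ^+ 2)) <= X.
Proof.
move=> hL hl hX Q0 hQ hM eta0 etal etaQ hC hn H.
have n0 : 0 < expR L := expR_gt0 L.
have L0 : 0 < L by lra.
have C0 : 0 < C1 by lra.
have l20 : 0 < l ^+ 2 by rewrite exprn_gt0 //; lra.
have Cl : 0 < C1 * l ^+ 2 by rewrite mulr_gt0.
rewrite mulrA ler_pdivrMr //.
have triv : L ^+ 2 * eta <= C1 * l ^+ 2 -> expR L * L ^+ 2 * eta <= X * (C1 * l ^+ 2).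
  move=> h; rewrite -mulrA; apply: ler_pM => //; first exact: ltW.
  by apply: mulr_ge0 => //; apply: exprn_ge0; lra.
(* If [m / n] exceeds [L ^+ 2], the claim falls below the trivial bound because [eta <= n / m]. *)
have [hr|hr] := ltP (L ^+ 2) (expR l).
  apply: triv; have : L ^+ 2 * eta <= 1.
    by apply: le_trans etal; rewrite mulrC ler_wpM2l // ltW.
  have : (1 / 2) ^+ 2 <= l ^+ 2 by rewrite lerXn2r ?nnegrE //; lra.
  move=> h1 h2; apply: le_trans h2 _.
  have : 10 ^+ 11 * (1 / 2) ^+ 2 <= C1 * l ^+ 2 by apply: ler_pM => //; rewrite ?exprn_ge0 //; lra.
  lra.
pose La := 8 * l; have La4 : 4 <= La by rewrite /La; lra.
(* The depth for which [expR (12 * (h * La))] uses only half of the exponent [L]. *)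
pose h := Num.truncn (L / (24 * La)).
have /andP[h1 h2] : h%:R <= L / (24 * La) < h.+1%:R.
  by apply: Num.Theory.truncn_itv; apply: divr_ge0; lra.
(* If this depth is too small, then [L <= 120 * La ^+ 2], and [l ^+ 2 * eta <= 4] makes the claim
   trivial again. *)
have [hh|hh] := ltP h%:R (4 * La).
  apply: triv.
  have Ll : L <= 120 * La ^+ 2.
    move: h2; rewrite ltr_pdivrMr; last lra.
    rewrite -natr1 => h2.
    have : (h%:R + 1) * (24 * La) <= 5 * La * (24 * La) by apply: ler_wpM2r; lra.
    by rewrite expr2; lra.
  have L2 : L ^+ 2 <= (120 * La ^+ 2) ^+ 2 by rewrite !expr2; apply: ler_pM => //; lra.
  have l2 : l ^+ 2 <= 4 * expR l.
    have e : expR l = expR (l / 2) ^+ 2 by rewrite -expRM_natr; congr expR; lra.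
    have : (l / 2) ^+ 2 <= expR (l / 2) ^+ 2.
      rewrite lerXn2r ?nnegrE ?expR_ge0 //; first lra.
      by apply: le_trans (expR_ge1Dx _); lra.
    by rewrite -e; lra.
  have le2 : l ^+ 2 * eta <= 4.
    by have := ler_wpM2r eta0 l2; lra.
  apply: le_trans (ler_wpM2r eta0 L2) _.
  have -> : (120 * La ^+ 2) ^+ 2 * eta = (120 * 64) ^+ 2 * l ^+ 2 * (l ^+ 2 * eta).
    by rewrite /La; ring.
  have : (120 * 64) ^+ 2 * l ^+ 2 * (l ^+ 2 * eta) <= (120 * 64) ^+ 2 * l ^+ 2 * 4.
    by apply: ler_wpM2l => //; apply: mulr_ge0; [apply: exprn_ge0; lra | exact: ltW].
  have : 10 ^+ 11 * l ^+ 2 <= C1 * l ^+ 2 by rewrite ler_pM2r.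
  lra.
have hLa : h%:R * La <= L / 24.
  move: h1; rewrite ler_pdivlMr; last lra.
  lra.
have hLe : h%:R <= L by have := ler_wpM2l (ler0n R h) La4; lra.
have big : (64 * Q + h%:R / (4 * La)) * expR (12 * (h%:R * La)) <= M0.
  apply: le_trans hM.
  have e : expR L = expR (L / 2) * expR (L / 2) by rewrite -expRD; congr expR; lra.
  have E : expR (12 * (h%:R * La)) <= expR (L / 2) by rewrite ler_expR; lra.
  have B : 64 * Q + h%:R / (4 * La) <= expR (L / 2) / 4.
    have h3 : h%:R / (4 * La) <= L.
      rewrite ler_pdivrMr; last lra.
      apply: le_trans hLe _; rewrite ler_peMr ?(ltW L0) //; lra.
    have LL : L <= L ^+ 2 by rewrite expr2 ler_peMl //; lra.
    have : 64 * Q + L <= (64 * 129 + 1) * L ^+ 2 by lra.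
    have c3 : (L / 2) ^+ 3 / 6 <= expR (L / 2) by apply: expR_ge_cube; lra.
    have : 10 ^+ 7 * L ^+ 2 <= L ^+ 3 by rewrite (exprS L 2) ler_pM2r // exprn_gt0.
    move: c3; rewrite (_ : (L / 2) ^+ 3 / 6 = L ^+ 3 / 48); last by field.
    have : 0 <= L ^+ 2 by apply: exprn_ge0; lra.
    lra.
  have Q' : 0 <= 64 * Q + h%:R / (4 * La).
    by apply: addr_ge0; [lra | apply: divr_ge0 => //; lra].
  apply: le_trans (ler_pM Q' (expR_ge0 _) B E) _.
  by rewrite e; lra.
have := H h hh big; rewrite -/La => HB.
(* As [h] is at least 1, truncation loses at most a factor 2. *)
have hlow : L / (48 * La) <= h%:R.
  have : L / (48 * La) = L / (24 * La) / 2 by field; rewrite gt_eqF //; lra.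
  by move: h2 hh; rewrite -natr1; lra.
have h2low : (L / (48 * La)) ^+ 2 <= h%:R ^+ 2.
  by rewrite lerXn2r ?nnegrE //; apply: divr_ge0; lra.
have HB' : expR L / 2 * ((L / (48 * La)) ^+ 2 / (4 * La)) <= 68 * (Q * X).
  apply: le_trans HB; apply: ler_pM => //; first lra.
    by apply: divr_ge0; [apply: exprn_ge0; apply: divr_ge0; lra | lra].
  by rewrite ler_wpM2r // invr_ge0; lra.
have HB2 : expR L * L ^+ 2 <= 68 * (2 * 48 ^+ 2 * 4 * 8 ^+ 3) * (Q * X) * l ^+ 3.
  have l30 : 0 < l ^+ 3 by rewrite exprn_gt0 //; lra.
  have -> : expR L * L ^+ 2 = expR L / 2 * ((L / (48 * La)) ^+ 2 / (4 * La)) * ((2 * 48 ^+ 2 * 4 * 8 ^+ 3) * l ^+ 3).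
    by rewrite /La; field; rewrite gt_eqF //; lra.
  apply: le_trans (ler_wpM2r _ HB') _; first by apply: mulr_ge0; [lra | exact: ltW].
  by lra.
apply: le_trans (ler_wpM2r eta0 HB2) _.
have -> : 68 * (2 * 48 ^+ 2 * 4 * 8 ^+ 3) * (Q * X) * l ^+ 3 * eta =
    68 * (2 * 48 ^+ 2 * 4 * 8 ^+ 3) * (eta * Q * l) * (X * l ^+ 2) by ring.
have X0 : 0 <= X * l ^+ 2 by apply: mulr_ge0; lra.
have -> : X * (C1 * l ^+ 2) = C1 * (X * l ^+ 2) by ring.
by apply: ler_wpM2r => //; lra.
Qed.

Lemma free_key r (Y : {set 'I_r}) (x z : 'I_r) : z \in Y -> (keys Y x z < z - x)%N ->
  exists y : 'I_r, y \notin Y /\ (x < y < z)%N.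
Proof.
move=> zY hk; have [/existsP[y /andP[yN hy]]|] := boolP [exists y, (y \notin Y) && (x < y < z)%N].
  by exists y.
rewrite negb_exists => /forallP full; move: hk; rewrite ltnNge => /negP; case.
rewrite -[X in (X <= _)%N](card_ord (z - x)).
have lt (i : 'I_(z - x)) : (x + i.+1 < r)%N.
  by apply: leq_ltn_trans (ltn_ord z); have := ltn_ord i; clear; lia.
have inj : injective (fun i => Ordinal (lt i)).
  move=> i j /(congr1 val) /= /eqP; rewrite eqn_add2l => /eqP[h]; exact: ord_inj.
rewrite -(card_imset _ inj); apply/subset_leq_card/subsetP => v /imsetP[i _ ->].
have hi := ltn_ord i; rewrite inE /= -[X in (X < _)%N]addn0 ltn_add2l /=.
have le_z : (x + i.+1 <= z)%N by move: hi; clear; lia.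
rewrite le_z andbT; move: le_z; rewrite leq_eqVlt => /orP[/eqP e|h].
  by rewrite (_ : Ordinal (lt i) = z) //; apply: ord_inj.
have := full (Ordinal (lt i)); rewrite negb_and negbK /= => /orP[//|].
by rewrite h -{1}[nat_of_ord x]addn0 ltn_add2l.
Qed.

(** Gaps that can be halved once in each of the [n - t] remaining steps. *)
Definition wide_gaps n r t (Y : {set 'I_r}) :=
  forall x z, x \in Y -> z \in Y -> (x < z)%N -> (x + 2 ^ (n - t) <= z)%N.

Lemma wide_gaps_pick n r t (Y : {set 'I_r}) (x z : 'I_r) : (t < n)%N -> wide_gaps n t Y ->
  x \in Y -> z \in Y -> (x < z)%N ->
  exists y : 'I_r, [/\ y \notin Y, (x < y < z)%N & wide_gaps n t.+1 (y |: Y)].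
Proof.
move=> tn wg xY zY xz; have hxz := wg x z xY zY xz.
have e2 : (2 ^ (n - t) = 2 * 2 ^ (n - t.+1))%N by rewrite -expnS subnSK.
have p0 : (0 < 2 ^ (n - t.+1))%N by rewrite expn_gt0.
set k := (2 ^ (n - t.+1))%N in e2 p0.
have lt : (x + k < r)%N by apply: leq_ltn_trans (ltn_ord z); order_lia.
pose y := Ordinal lt.
have yN : y \notin Y.
  apply/negP => yY; have xy : (x < y)%N by rewrite /= -[X in (X < _)%N]addn0 ltn_add2l.
  by have := wg x y xY yY xy; rewrite /= leq_add2l e2; order_lia.
exists y; split=> //; first by rewrite /=; order_lia.
rewrite /wide_gaps -/k => u v; rewrite !in_setU1 => /orP[/eqP ->|uY] /orP[/eqP ->|vY] uv.
- by rewrite ltnn in uv.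
- have xv : (x < v)%N by move: uv; rewrite /=; order_lia.
  by have := wg x v xY vY xv; rewrite e2 /=; order_lia.
- have [ux|xu] := leqP u x; first by rewrite /= leq_add2r.
  by have := wg x u xY uY xu; move: uv; rewrite e2 /=; order_lia.
- by have := wg u v uY vY uv; rewrite e2; order_lia.
Qed.

(** * Choice of parameters for the two bounds *)

Section FinalBounds.
Variables (R : realType) (n m r : nat) (C1 : R).
Hypotheses (nC1 : expR (10 ^+ 7) <= n%:R :> R) (C1ge : 10 ^+ 11 <= C1) (C1n : C1 <= n%:R).
Hypotheses (nm : (2 * n <= m)%N) (mr : (m < r)%N).

Let n_gt7 : (7 < n)%N.
Proof.
rewrite -(ltr_nat R); apply: lt_le_trans C1n; apply: lt_le_trans C1ge.
by lra.
Qed.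

Let l : R := ln (m%:R / n%:R).
Let n0 := n./2.

Let nR0 : 0 < n%:R :> R. Proof. by rewrite ltr0n; move: n_gt7; case: n. Qed.
Let mR0 : 0 < m%:R :> R. Proof. by rewrite ltr0n; move: n_gt7 nm; order_lia. Qed.
Let rho_gt0 : 0 < m%:R / n%:R :> R. Proof. by rewrite divr_gt0. Qed.
Let lE : expR l = m%:R / n%:R. Proof. by rewrite lnK ?posrE. Qed.
Let LE : expR (ln n%:R) = n%:R :> R. Proof. by rewrite lnK ?posrE. Qed.
Let rho_ge2 : 2 <= expR l.
Proof. by rewrite lE ler_pdivlMr // -natrM ler_nat. Qed.

Let l_ge : 1 / 2 <= l.
Proof.
rewrite -ler_expR; apply: le_trans rho_ge2; exact: expR_half_le2.
Qed.

Let n0_ge : (n <= 4 * n0.-1)%N.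
Proof. by rewrite /n0; move: n_gt7; order_lia. Qed.

Let n0_bounds : (1 < n0 <= n)%N.
Proof. by rewrite /n0; move: n_gt7; order_lia. Qed.

(** Half of the steps set up the initial keys. [La = 8 * l] is admissible since
    [expR 1 * Q <= 4 * Q <= D0 * expR l ^+ 8]. *)
Lemma chi_bound (lam Q D0 eta : R) G (avail : nat -> {set 'I_r} -> Prop) :
  0 <= lam -> 0 < Q -> 0 < D0 -> Q <= 129 * expR l -> 4 * Q <= D0 * expR l ^+ 8 ->
  n%:R / 4 <= D0 * m%:R -> 0 <= eta -> eta * expR l <= 1 -> eta * Q * l <= 129 ->
  (0 < G)%N -> (n0.-1 * G < r)%N -> lam * G%:R + 1 <= Q ->
  D0 * m%:R <= lam * (n0.-1 * G)%:R + n0.-1%:R ->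
  avail n0 (multiples r G n0) ->
  (forall t Y (x z : 'I_r), (t < n)%N -> avail t Y -> x \in Y -> z \in Y -> (x < z)%N ->
     D0 * (keys Y x z)%:R <= 16 * mass lam Y x z ->
     exists y : 'I_r, [/\ y \notin Y, (x < y < z)%N & avail t.+1 (y |: Y)]) ->
  n%:R * ln n%:R ^+ 2 * (eta / (C1 * l ^+ 2)) <= (chi n m r)%:R.
Proof.
move=> lam0 Q0 D00 hQ hQD hM0 eta0 etal etaQ G0 Gr gapQ hM avl pick.
have np : (0 < n)%N by move: n_gt7; case: n.
have lnm : (n <= m)%N by move: nm; order_lia.
rewrite -{1}LE; apply: (@bound_from_depths _ _ _ Q (D0 * m%:R) _ _ _ (n - n0)%:R) => //.
- by rewrite -ler_expR LE.
- by rewrite LE ler_nat chi_ge // (leq_trans lnm) // ltnW.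
- by rewrite LE.
- by rewrite LE ler_pdivrMr // -natrM ler_nat /n0; order_lia.
move=> h hh hbig.
have [A lA Achi] := chi_attained r np lnm.
have hl8 : expR (8 * l) = expR l ^+ 8 by rewrite expRM_natl.
have [|||s us hs] := @game_bound R n m r n0 G h A lam Q D0 (8 * l) avail lA _ lam0 Q0 D00 _ _ hh
  hbig n0_bounds G0 Gr gapQ hM avl pick.
- by rewrite -(ltr_nat R).
- by move: l_ge; lra.
- rewrite hl8; apply: le_trans hQD; rewrite ler_wpM2r ?(ltW Q0) //; exact: expR1_le4.
apply: le_trans hs _; rewrite ler_wpM2l // ler_wpM2l ?(ltW Q0) // ler_nat -Achi.
exact: leq_bigmax_cond.
Qed.

Let delta : R := n%:R / m%:R.
Let deltaE : delta * expR l = 1.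
Proof. by rewrite lE /delta mulrA divfK ?divff // gt_eqF. Qed.
Let delta_gt0 : 0 < delta. Proof. by rewrite divr_gt0. Qed.
Let delta_l : delta * l <= 1.
Proof.
rewrite -deltaE ler_pM2l //; apply: le_trans (expR_ge1Dx _); lra.
Qed.
Let rho7 : 128 <= expR l ^+ 7.
Proof.
apply: le_trans (_ : 2 ^+ 7 <= _); first by lra.
by rewrite lerXn2r ?nnegrE ?expR_ge0.
Qed.

(** Free keys are guaranteed by exponentially wide gaps, so mass may count stored keys alone, with
    [lam = 0] and [Q = 1]. *)
Lemma chi_bound_many_keys : (n * 2 ^ (n - 1) <= r)%N ->
  n%:R * ln n%:R ^+ 2 * (delta / (C1 * l ^+ 2)) <= (chi n m r)%:R.
Proof.
move=> hr; have n1 : 0 < n0.-1%:R :> R by rewrite ltr0n; move: n_gt7 n0_ge; order_lia.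
have n4 : n%:R <= 4 * n0.-1%:R :> R by rewrite -natrM ler_nat.
apply: (@chi_bound 0 1 (n0.-1%:R / m%:R) delta (2 ^ (n - 1)) (@wide_gaps n r)) => //.
- by rewrite divr_gt0.
- by move: rho_ge2; lra.
- have : 1 / 4 <= n0.-1%:R / m%:R * expR l.
    by rewrite lE mulrA divfK ?gt_eqF // ler_pdivlMr //; move: n4; lra.
  rewrite (exprS _ 7) mulrA => h.
  have := ler_pM (_ : 0 <= 1 / 4 :> R) (ler0n R 128) h rho7; move=> /(_ _); lra.
- by rewrite divfK ?gt_eqF //; move: n4; lra.
- exact: ltW.
- by rewrite deltaE.
- by rewrite mulr1; move: delta_l; lra.
- by rewrite expn_gt0.
- apply: leq_trans hr; rewrite ltn_mul2r expn_gt0 /=; move: n0_bounds; order_lia.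
- by rewrite mul0r add0r.
- by rewrite mul0r add0r divfK ?gt_eqF.
- move=> x z xM zM xz; apply: leq_trans (multiples_gap xM zM xz).
  by rewrite leq_add2l leq_exp2l //; move: n0_bounds; order_lia.
- by move=> t Y x z tn wg xY zY xz _; apply: wide_gaps_pick.
Qed.

Lemma chi_bound_few_keys : C1 * m%:R <= r%:R ->
  n%:R * ln n%:R ^+ 2 * (delta ^+ 2 / (C1 * l ^+ 2)) <= (chi n m r)%:R.
Proof.
move=> hr; have n1 : 0 < n0.-1%:R :> R by rewrite ltr0n; move: n_gt7 n0_ge; order_lia.
have n4 : n%:R <= 4 * n0.-1%:R :> R by rewrite -natrM ler_nat.
pose G := (r %/ n0)%N.
have n00 : (0 < n0)%N by move: n0_bounds; order_lia.
have G0 : (0 < G)%N by rewrite divn_gt0 //; move: n0_bounds nm mr; order_lia.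
have GR : 0 < G%:R :> R by rewrite ltr0n.
(* Spreads mass [32 * m], that is density [D0 = 32] on the whole array, over [n0.-1] gaps of length
   [G]. *)
pose lam : R := 32 * m%:R / (n0.-1%:R * G%:R).
have lam0 : 0 <= lam by rewrite divr_ge0 // mulr_ge0 // ltW.
have lamG : lam * G%:R = 32 * m%:R / n0.-1%:R.
  by rewrite /lam; field; rewrite !gt_eqF.
have mn : 32 * m%:R / n0.-1%:R <= 128 * expR l.
  rewrite lE ler_pdivrMr // -mulrA mulrAC mulrA ler_pdivlMr //.
  by have := ler_wpM2l (ltW mR0) n4; lra.
have lam1 : lam < 1.
  rewrite /lam ltr_pdivrMr ?mulr_gt0 // mul1r.
  have h1 : (r < G.+1 * n0)%N by rewrite /G ltn_ceil.
  have h2 : (n0 <= 2 * n0.-1)%N by move: n0_bounds; order_lia.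
  have h3 : r%:R < (G%:R + 1) * n0%:R :> R by rewrite natr1 -natrM ltr_nat.
  have h4 : n0%:R <= 2 * n0.-1%:R :> R by rewrite -natrM ler_nat.
  have h5 : (G%:R + 1) * n0%:R <= 2 * (n0.-1%:R * G%:R) + m%:R :> R.
    have : n0%:R <= m%:R :> R by rewrite ler_nat; move: n0_bounds nm; order_lia.
    by have := ler_wpM2l (ltW GR) h4; lra.
  have h6 : 10 ^+ 11 * m%:R <= C1 * m%:R by rewrite ler_pM2r.
  by move: hr mR0; lra.
pose Q := lam * G%:R + 1.
have Q0 : 0 < Q by rewrite /Q lamG; apply: addr_gt0 => //; rewrite divr_gt0 // mulr_gt0.
(* Now [Q] may be of order [m / n] instead of 1, which costs the second factor [delta]. *)
have hQ : Q <= 129 * expR l by rewrite /Q lamG; move: mn rho_ge2; lra.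
apply: (@chi_bound lam Q 32 (delta ^+ 2) G (fun _ _ => True)) => //.
- rewrite (exprS _ 7).
  have : 128 * expR l <= expR l ^+ 7 * expR l by rewrite ler_pM2r ?expR_gt0.
  by move: hQ (expR_ge0 l); lra.
- by have := nm; rewrite -(ler_nat R) natrM; move: nR0; lra.
- by rewrite exprn_ge0 // ltW.
- rewrite expr2 -mulrA deltaE mulr1 -deltaE ler_peMr ?(ltW delta_gt0) //.
  by move: rho_ge2; lra.
- have := ler_wpM2l (ltW delta_gt0) hQ; rewrite mulrCA deltaE mulr1 => hd.
  have : delta * Q * (delta * l) <= 129 * 1.
    apply: ler_pM => //; first by rewrite mulr_ge0 ?ltW.
    by rewrite mulr_ge0 ?(ltW delta_gt0) //; move: l_ge; lra.
  by rewrite expr2; lra.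
- apply: leq_trans (leq_trunc_div r n0); rewrite mulnC ltn_mul2l G0 /=.
  by move: n00; case: n0.
- rewrite natrM /lam divfK ?mulf_neq0 ?gt_eqF //; by move: n1; lra.
- move=> t Y x z _ _ xY zY xz hk.
  (* From [32 * keys <= 16 * (lam * (z - x) + keys)] follows [keys <= lam * (z - x)], and [lam < 1]
     leaves a free key. *)
  have lt : (keys Y x z < z - x)%N.
    rewrite -(ltr_nat R) natrB ?(ltnW xz) //.
    have xz' : (x : nat)%:R < (z : nat)%:R :> R by rewrite ltr_nat.
    have := ltr_pM2r (_ : 0 < (z : nat)%:R - (x : nat)%:R :> R) lam 1.
    rewrite subr_gt0 lam1 mul1r => /(_ xz') lt1.
    by move: hk; rewrite /mass; lra.
  by have [y [yN hy]] := free_key zY lt; exists y.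
Qed.

End FinalBounds.

Theorem theorem1 (R : realType) :
  exists C1 : R, 0 < C1 /\
    forall n m r : nat,
      C1 <= n%:R -> (2 * n <= m)%N -> (m < r)%N ->
      let delta : R := n%:R / m%:R in
      ((n * 2 ^ (n - 1) <= r)%N ->
         n%:R * ln n%:R ^+ 2 * (delta / (C1 * ln (1 / delta) ^+ 2))
           <= (chi n m r)%:R)
      /\
      (C1 * m%:R <= r%:R ->
         n%:R * ln n%:R ^+ 2 * (delta ^+ 2 / (C1 * ln (1 / delta) ^+ 2))
           <= (chi n m r)%:R).
Proof.
have E0 := expR_gt0 (10 ^+ 7 : R).
(* The first summand forces [ln n >= 10 ^+ 7]; the second absorbs the constants of the estimates. *)
exists (expR (10 ^+ 7) + 10 ^+ 11); split; first by lra.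
move=> n m r hn hnm hmr delta.
have e1 : expR (10 ^+ 7) <= n%:R :> R by move: hn; lra.
have e2 : 10 ^+ 11 <= expR (10 ^+ 7) + 10 ^+ 11 :> R by lra.
rewrite (_ : 1 / delta = m%:R / n%:R); last by rewrite /delta div1r invf_div.
split=> hr; first exact: chi_bound_many_keys.
exact: chi_bound_few_keys.
Qed.
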